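(* Let $\eta\in\mathbb{R}^3$ be a unit vector, $z\in\mathbb{R}$, and $P_{\eta,z}=\{x\in\mathbb{R}^3: x\cdot\eta=z\}$. Let $B=(B_1,B_2,B_3)$ be a vector field with values in $\mathbb{R}^3$ whose restriction to $P_{\eta,z}$ is smooth with compact support. For a field $B$ that is small in the plane $P_{\eta,z}$, the linear approximation (linearization of $\mathcal{S}$ about the zero field) gives, for $x\in P_{\eta,z}$ and unit vectors $\xi$ with $\xi\cdot\eta=0$, $$e_1\cdot\mathcal{S}(B)(x,\xi)\,e_2=\frac{\gamma_N}{v}X(B_3)(x,\xi)+O(|B|)^2,$$ and the same holds with cyclic permutations of the indices $(1,2,3)$, i.e. $$e_2\cdot\mathcal{S}(B)(x,\xi)\,e_3=\frac{\gamma_N}{v}X(B_1)(x,\xi)+O(|B|)^2,\qquad e_3\cdot\mathcal{S}(B)(x,\xi)\,e_1=\frac{\gamma_N}{v}X(B_2)(x,\xi)+O(|B|)^2.$$ Hence, in this linear approximation, the magnetic field can be retrieved on the plane, and this can be done using any two-dimensional Radon inversion method.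
   Context: Here $\gamma_N\neq 0$ and $v>0$ are fixed real constants (the gyromagnetic ratio of the neutron and the neutron speed) and $e_1,e_2,e_3$ is the standard basis of $\mathbb{R}^3$. For $b=(b_1,b_2,b_3)\in\mathbb{R}^3$, $$H(b)=\begin{pmatrix} 0 & b_3 & -b_2 \\ -b_3 & 0 & b_1 \\ b_2 & -b_1 & 0 \end{pmatrix}.$$ For $x\in P_{\eta,z}$ and a unit vector $\xi$ with $\xi\cdot\eta=0$, the $3\times3$ matrix-valued function $\Sigma$ associated with a vector field $B$ is the solution along the line $s\mapsto x+s\xi$ of $$\frac{\partial}{\partial s}\Sigma(x+s\xi,\xi)=\frac{\gamma_N}{v}H(B(x+s\xi))\,\Sigma(x+s\xi,\xi),\qquad \lim_{s\to-\infty}\Sigma(x+s\xi,\xi)=I,$$ where $I$ is the $3\times 3$ identity matrix, and the (non-linear) forward map is $\mathcal{S}(B)(x,\xi)=\lim_{s\to\infty}\Sigma(x+s\xi,\xi)$. The scalar Radon transform in the plane of a function $f$ on $P_{\eta,z}$ is the line integral $X(f)(x,\xi)=\int_{-\infty}^{\infty}f(x+s\xi)\,ds$. The term $O(|B|)^2$ denotes an error of second order in the small field $B$. *)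

(* Defs.v *)
From mathcomp Require Import all_boot all_order all_algebra.
From mathcomp Require Import all_classical all_reals all_analysis.

Set Implicit Arguments.
Unset Strict Implicit.
Unset Printing Implicit Defensive.

Import Order.TTheory GRing.Theory Num.Theory.
Import numFieldNormedType.Exports.

Local Open Scope classical_set_scope.
Local Open Scope ring_scope.

(* Vectors of R^3 are columns.  The indices 1, 2, 3 of the mathematics are
   0, 1, 2 : 'I_3; addition in 'I_3 is modulo 3, so that (i, i + 1, i + 2)
   runs through the cyclic permutations of (1, 2, 3).  The library norm on
   'cV[R]_3 is the max norm, hence the explicit Euclidean one below. *)

Definition dot (R : realType) (u w : 'cV[R]_3) : R := (u^T *m w) 0 0.

Definition enorm (R : realType) (u : 'cV[R]_3) : R := Num.sqrt (dot u u).

Definition stdbasis (R : realType) (i : 'I_3) : 'cV[R]_3 := delta_mx i 0.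

Definition plane (R : realType) (eta : 'cV[R]_3) (z : R) : set 'cV[R]_3 :=
  [set x | dot x eta = z].

Definition direction (R : realType) (eta xi : 'cV[R]_3) : Prop :=
  enorm xi = 1 /\ dot xi eta = 0.

Definition component (R : realType) (B : 'cV[R]_3 -> 'cV[R]_3) (i : 'I_3)
  : 'cV[R]_3 -> R := fun x => B x i 0.

Definition iter_derive (R : realType) (us : seq 'cV[R]_3) (f : 'cV[R]_3 -> R)
  : 'cV[R]_3 -> R := foldr (fun u g => 'D_u g) f us.

(* Smoothness of the restriction of f to the plane: only derivatives in
   directions parallel to the plane are taken, and at a point of the plane
   these depend on the values of f on the plane only. *)
Definition smooth_on_plane (R : realType) (eta : 'cV[R]_3) (z : R)
    (f : 'cV[R]_3 -> R) : Prop :=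
  forall us : seq 'cV[R]_3, (forall u, u \in us -> dot u eta = 0) ->
    {within plane eta z, continuous (iter_derive us f)} /\
    (forall u x, dot u eta = 0 -> plane eta z x ->
       derivable (iter_derive us f) x u).

(* The plane being closed in R^3, the closure below is also the closure
   relative to the plane. *)
Definition compact_support_on_plane (R : realType) (eta : 'cV[R]_3) (z : R)
    (f : 'cV[R]_3 -> R) : Prop :=
  compact (closure [set x | plane eta z x /\ f x != 0]).

Definition test_function (R : realType) (eta : 'cV[R]_3) (z : R)
    (f : 'cV[R]_3 -> R) : Prop :=
  smooth_on_plane eta z f /\ compact_support_on_plane eta z f.

Definition test_field (R : realType) (eta : 'cV[R]_3) (z : R)
    (B : 'cV[R]_3 -> 'cV[R]_3) : Prop :=
  forall i : 'I_3, test_function eta z (component B i).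

Definition field_norm (R : realType) (eta : 'cV[R]_3) (z : R)
    (B : 'cV[R]_3 -> 'cV[R]_3) : R :=
  sup [set enorm (B x) | x in plane eta z].

Definition Hmx (R : realType) (b : 'cV[R]_3) : 'M[R]_3 :=
  let b1 := b 0 0 in let b2 := b 1 0 in let b3 := b 2%:R 0 in
  \matrix_(i < 3, j < 3)
    nth 0 (nth [::] [:: [::   0;  b3; - b2];
                        [:: - b3;  0;   b1];
                        [::  b2; - b1;   0]] i) j.

Definition is_Sigma (R : realType) (gammaN v : R) (eta : 'cV[R]_3) (z : R)
    (B : 'cV[R]_3 -> 'cV[R]_3) (Sigma : 'cV[R]_3 -> 'cV[R]_3 -> 'M[R]_3)
  : Prop :=
  forall x xi, plane eta z x -> direction eta xi ->
    (forall s : R, is_derive s 1 (fun s : R => Sigma (x + s *: xi) xi)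
       ((gammaN / v) *: (Hmx (B (x + s *: xi)) *m Sigma (x + s *: xi) xi))) /\
    (Sigma (x + s *: xi) xi @[s --> -oo] --> (1%:M : 'M[R]_3)).

(* The solution is selected by choice, with the zero function as junk value
   should there be none; for a test field it exists, and it is unique at
   points of the plane and directions parallel to it. *)
Definition Sigma_of (R : realType) (gammaN v : R) (eta : 'cV[R]_3) (z : R)
    (B : 'cV[R]_3 -> 'cV[R]_3) : 'cV[R]_3 -> 'cV[R]_3 -> 'M[R]_3 :=
  xget (fun _ _ => 0) [set Sigma | is_Sigma gammaN v eta z B Sigma].

Definition forward (R : realType) (gammaN v : R) (eta : 'cV[R]_3) (z : R)
    (B : 'cV[R]_3 -> 'cV[R]_3) (x xi : 'cV[R]_3) : 'M[R]_3 :=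
  lim (Sigma_of gammaN v eta z B (x + s *: xi) xi @[s --> +oo]).

Definition scale_field (R : realType) (t : R) (B : 'cV[R]_3 -> 'cV[R]_3)
  : 'cV[R]_3 -> 'cV[R]_3 := fun x => t *: B x.

(* Directional derivative of the forward map at the zero field, in the
   direction B. *)
Definition linearized_forward (R : realType) (gammaN v : R)
    (eta : 'cV[R]_3) (z : R) (B : 'cV[R]_3 -> 'cV[R]_3) (x xi : 'cV[R]_3)
  : 'M[R]_3 :=
  derive1 (fun t : R => forward gammaN v eta z (scale_field t B) x xi) 0.

Definition matrix_coef (R : realType) (A : 'M[R]_3) (i j : 'I_3) : R :=
  dot (stdbasis R i) (A *m stdbasis R j).

Definition Xray (R : realType) (f : 'cV[R]_3 -> R) (x xi : 'cV[R]_3) : R :=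
  \int[lebesgue_measure]_s f (x + s *: xi).

(* A two-dimensional Radon inversion method on the plane: a map recovering on
   the plane every test function f from data that agree with the line
   integrals of f over the lines of the plane. *)
Definition Radon_inversion (R : realType) (eta : 'cV[R]_3) (z : R)
    (Inv : ('cV[R]_3 -> 'cV[R]_3 -> R) -> 'cV[R]_3 -> R) : Prop :=
  forall f g, test_function eta z f ->
    (forall x xi, plane eta z x -> direction eta xi -> g x xi = Xray f x xi) ->
    forall y, plane eta z y -> Inv g y = f y.

(* Main.v *)
(* Along a line the generator [c H(B)] is skew-symmetric, so every solution has columns of constant
   length; this gives uniqueness and the bound 1 on the entries, while existence is a Picard iteration.
   The entries of [Sigma - I] are therefore of first order in [B], and integrating the equation once
   more shows that [S(B) - I - c \int H(B)] is of second order; the linearization follows by applying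
   this to [t B].  Since an inversion method exists as soon as the line integrals determine a test
   function, what remains is the injectivity of the planar X-ray transform on continuous functions
   of compact support, proved by computing moments. *)
Require Import Defs.
From mathcomp Require Import all_boot all_order all_algebra.
From mathcomp Require Import all_classical all_reals all_analysis.
From mathcomp Require Import ring lra.
Import Order.TTheory GRing.Theory Num.Theory.
Import numFieldNormedType.Exports.
Local Open Scope classical_set_scope.
Local Open Scope ring_scope.

Set Implicit Arguments.
Unset Strict Implicit.
Unset Printing Implicit Defensive.

(** Compact support turns both limits at infinity into values: along each line the solution is
    exactly [I] before an interval of length [6 * r + 2] and constant after it, where [r] bounds the
    coordinates on the support. This length is the same for all lines, so one constant,
    [(3 * |c| * (6 * r + 2)) ^+ 2] with [c = gammaN / v], serves for all of them; the 3 is the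
    number of terms in an entry of a matrix product. The entry bound 1 coming from skew-symmetry
    keeps this constant polynomial, where Gronwall's inequality would give an exponential. The field
    is controlled on the plane only, so the analysis is done on restrictions to lines or in an
    affine chart of the plane. In the injectivity proof, integrals against polynomials take the
    place of Fourier analysis: the non-vertical lines of the chart give every mixed moment, and a
    compactly supported continuous function whose moments are all zero vanishes. *)

(** * Mean value comparisons and antiderivatives of compactly supported functions *)

Section Calculus.
Context {R : realType}.
Implicit Types (f g F G : R -> R) (a b x : R).
Local Notation mu := (@lebesgue_measure R).

Lemma is_derive_continuous F f : (forall x, is_derive x 1 F (f x)) -> continuous F.
Proof.
move=> dF x; apply: differentiable_continuous; apply/derivable1_diffP.
by have [] := dF x.
Qed.

(** [G + F] and [G - F] have nonnegative derivative on [[a, b]] and nonnegative value at [a]. In the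
    study of differential equations this comparison plays the part of bounding an integral by the
    integral of a majorant. *)
Lemma is_derive_norm_le F f G g a b x :
  (forall x, is_derive x 1 F (f x)) -> (forall x, is_derive x 1 G (g x)) ->
  (forall y, a <= y <= b -> `|f y| <= g y) -> `|F a| <= G a ->
  a <= x <= b -> `|F x| <= G x.
Proof.
move=> dF dG fg Fa /andP[ax xb].
have cts (H h : R -> R) : (forall x, is_derive x 1 H (h x)) -> {within `[a, x], continuous H}.
  by move=> dH; apply: continuous_subspaceT; apply: is_derive_continuous dH.
have ab c : c \in `[a, x] -> a <= c <= b.
  by rewrite in_itv/= => /andP[-> cx]; rewrite (le_trans cx xb).
have xa : 0 <= x - a by rewrite subr_ge0.
move: Fa; rewrite !ler_norml => /andP[Fa1 Fa2]; apply/andP; split.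
  have dP : forall y : R, is_derive y 1 (F + G) (f y + g y) by move=> y; apply: is_deriveD.
  have [c /ab cab] := MVT_segment ax (fun y _ => dP y) (cts _ _ dP).
  have : 0 <= (f c + g c) * (x - a).
    by rewrite mulr_ge0//; have := fg c cab; rewrite ler_norml => /andP[]; lra.
  by rewrite !fctE/=; lra.
have dP : forall y : R, is_derive y 1 (G - F) (g y - f y) by move=> y; apply: is_deriveB.
have [c /ab cab] := MVT_segment ax (fun y _ => dP y) (cts _ _ dP).
have : 0 <= (g c - f c) * (x - a).
  by rewrite mulr_ge0//; have := fg c cab; rewrite ler_norml => /andP[]; lra.
by rewrite !fctE/=; lra.
Qed.

Lemma is_derive0_eq F f a b : (forall x, is_derive x 1 F (f x)) -> a <= b ->
  (forall x, a <= x <= b -> f x = 0) -> F a = F b.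
Proof.
move=> dF ab f0.
have [|c] := @MVT_segment R F f a b ab (fun y _ => dF y).
  by apply: continuous_subspaceT; apply: is_derive_continuous dF.
by rewrite in_itv/= => /f0 -> /eqP; rewrite mul0r subr_eq0 => /eqP.
Qed.

Lemma is_derive_eq_primitive F G f a x : (forall x, is_derive x 1 F (f x)) ->
  (forall x, is_derive x 1 G (f x)) -> F x - F a = G x - G a.
Proof.
move=> dF dG.
have dP : forall y : R, is_derive y 1 (F - G) 0.
  by move=> y; rewrite -(subrr (f y)); apply: is_deriveB.
have e u v : u <= v -> (F - G) u = (F - G) v.
  by move=> uv; apply: (is_derive0_eq dP).
have : (F - G) x = (F - G) a by have [/e->|/ltW/e->] := leP x a.
rewrite !fctE/=; lra.
Qed.

(** The inequalities are strict, so [f] vanishes at [a] and [b] too, which suits the closed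
    half-lines used below. *)
Definition vanishes_outside a b f := forall x, ~~ (a < x < b) -> f x = 0.

(** Based at minus infinity, so that the integral over the whole line is its value to the right of
    the support. *)
Definition primitive f x : R := \int[mu]_(t in `]-oo, x]) f t.

Lemma vanishes_restrict a b f : vanishes_outside a b f -> f \_ `[a, b] = f.
Proof.
move=> f0; apply/funext => x; rewrite patchE; case: ifPn => // /negP xab.
rewrite f0//; apply/negP => /andP[ax xb]; apply: xab.
by rewrite inE/= in_itv/= !ltW.
Qed.

Lemma vanishes_integrable a b f : continuous f -> vanishes_outside a b f ->
  mu.-integrable setT (EFin \o f).
Proof.
move=> cf f0; rewrite -(vanishes_restrict f0) -restrict_EFin.
apply/integrable_restrict => //=; rewrite setTI.
apply: continuous_compact_integrable; first exact: segment_compact.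
exact: continuous_subspaceT.
Qed.

Lemma is_derive_primitive a b f : continuous f -> vanishes_outside a b f ->
  forall x, is_derive x 1 (primitive f) (f x).
Proof.
move=> cf f0 x.
have x1 : x < x + 1 by rewrite ltrDl.
have i1 : mu.-integrable `]-oo, (x + 1)] (EFin \o f).
  exact: integrableS (vanishes_integrable cf f0).
have [d e] := continuous_FTC1 x1 i1 (ltNyr _) (cf x).
by apply: DeriveDef; [exact: d | rewrite -derive1E].
Qed.

Lemma primitive_left a b f x : vanishes_outside a b f -> x <= a -> primitive f x = 0.
Proof.
move=> f0 xa; rewrite /primitive.
rewrite (@eq_Rintegral _ _ _ mu _ (cst 0)) ?Rintegral_cst ?mul0r// => y.
rewrite inE/= in_itv/= => yx; apply: f0.
by rewrite negb_and -leNgt (le_trans yx xa).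
Qed.

Lemma primitive_right a b f x : vanishes_outside a b f -> b <= x ->
  primitive f x = \int[mu]_t f t.
Proof.
move=> f0 bx; rewrite /primitive Rintegral_mkcond; congr Rintegral.
apply/funext => y; rewrite patchE; case: ifPn => // /negP yx.
rewrite f0// negb_and -!leNgt; apply/orP; right.
by rewrite (le_trans bx)// leNgt; apply/negP => yx'; apply: yx; rewrite inE/= in_itv/= ltW.
Qed.

Lemma Rintegral_is_derive a b f F : continuous f -> vanishes_outside a b f ->
  (forall x, is_derive x 1 F (f x)) -> \int[mu]_t f t = F b - F a.
Proof.
move=> cf f0 dF; have dP := is_derive_primitive cf f0.
rewrite -(primitive_right f0 (lexx b)) -[LHS]subr0 -(primitive_left f0 (lexx a)).
exact: (is_derive_eq_primitive _ _ dP dF).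
Qed.

(* Primitives turn an affine change of variable into the chain rule. *)
Lemma Rintegral_affine a b f r c : 0 < r -> continuous f -> vanishes_outside a b f ->
  \int[mu]_t f (r * t + c) = r^-1 * \int[mu]_t f t.
Proof.
move=> r0 cf f0; have dP := is_derive_primitive cf f0.
have rn0 : r != 0 by rewrite gt_eqF.
have dF x : is_derive x 1 (fun t => r^-1 * primitive f (r * t + c)) (f (r * x + c)).
  have d1 : is_derive x 1 (fun t : R => r * t + c) r.
    by apply: is_derive_eq; rewrite addr0 scaler1.
  have d2 : is_derive x 1 (primitive f \o (fun t : R => r * t + c)) (f (r * x + c) * r).
    exact: is_derive1_comp.
  have d3 := is_deriveZ r^-1 d2; apply: (is_derive_eq d3).
  by rewrite /GRing.scale/= mulrCA mulVf// mulr1.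
have cg : continuous (fun t => f (r * t + c)).
  move=> x; apply: continuous_comp; last exact: cf.
  by apply: cvgD; [apply: cvgM; [exact: cvg_cst|exact: cvg_id]|exact: cvg_cst].
have g0 : vanishes_outside ((a - c) / r) ((b - c) / r) (fun t => f (r * t + c)).
  move=> x; rewrite ltr_pdivrMr// ltr_pdivlMr// => xab; apply: f0.
  by apply: contra xab; lra.
rewrite (Rintegral_is_derive cg g0 dF) -mulrBr; congr (_ * _).
rewrite (Rintegral_is_derive cf f0 dP).
by rewrite !(mulrC r) !divfK// !subrK.
Qed.

End Calculus.

(** * Global solutions of linear matrix equations by Picard iteration *)

Section Existence.
Context {R : realType}.

Lemma half_expn_gt0 n : 0 < (2^-1 : R) ^+ n.
Proof. by rewrite exprn_gt0// invr_gt0. Qed.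

Lemma half_expnS n : (2^-1 : R) ^+ n = 2 * 2^-1 ^+ n.+1.
Proof. by rewrite exprS mulrA mulfV// mul1r. Qed.

Lemma expn_small (z C e : R) : 0 < z < 1 -> 0 < e -> exists n, z ^+ n * C < e.
Proof.
move=> /andP[z0 z1] e0; have : (z ^+ n * C) @[n --> \oo] --> (0 * C : R).
  apply: cvgM; last exact: cvg_cst.
  by apply: cvg_expr; rewrite ger0_norm// ltW.
rewrite mul0r => /cvgrPdist_lt/(_ _ e0)[N _ /(_ N (leqnn _))]/=.
rewrite sub0r normrN => h; exists N; exact: le_lt_trans (ler_norm _) h.
Qed.

Lemma half_expn_small (C e : R) : 0 < e -> exists n, 2^-1 ^+ n * C < e.
Proof. by apply: expn_small; rewrite invr_gt0 invf_lt1// ltr0n ltr1n. Qed.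

Lemma half_expn_eq0 (x C : R) : (forall n, `|x| <= 2^-1 ^+ n * C) -> x = 0.
Proof.
move=> h; apply/eqP; rewrite -normr_le0 leNgt; apply/negP => x0.
by have [n] := half_expn_small C x0; rewrite ltNge h.
Qed.

(* The limit is the common value separating the adjacent sequences [u n - 2 c / 2 ^ n] and [u n + 2 c / 2 ^ n]. *)
Lemma geometric_limit (u : nat -> R) c :
  (forall n, `|u n.+1 - u n| <= 2^-1 ^+ n * c) ->
  exists l, forall n, `|l - u n| <= 2^-1 ^+ n * (2 * c).
Proof.
move=> uc.
have c0 : 0 <= c by have := uc 0%N; rewrite expr0 mul1r; exact: le_trans.
pose p n := u n - 2^-1 ^+ n * (2 * c); pose q n := u n + 2^-1 ^+ n * (2 * c).
have pS n : p n <= p n.+1.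
  have := uc n; rewrite /p (half_expnS n) ler_norml => /andP[]; lra.
have qS n : q n.+1 <= q n.
  have := uc n; rewrite /q (half_expnS n) ler_norml => /andP[]; lra.
have p_mono m k : p m <= p (m + k)%N.
  by elim: k => [|k ih]; rewrite ?addn0// addnS (le_trans ih).
have q_mono m k : q (m + k)%N <= q m.
  by elim: k => [|k ih]; rewrite ?addn0// addnS (le_trans _ ih).
have pq m n : p m <= q n.
  apply: (le_trans (p_mono m n)); rewrite addnC; apply: le_trans (q_mono n m).
  rewrite /p /q; have := half_expn_gt0 (n + m)%N; nra.
exists (sup (range p)) => n.
have h1 : p n <= sup (range p).
  apply: ub_le_sup; last by exists n.
  by exists (q 0%N) => _ [m _ <-].
have h2 : sup (range p) <= q n.
  by apply: ge_sup; [exists (p 0%N), 0%N|move=> _ [m _ <-]].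
by move: h1 h2; rewrite /p /q ler_norml; lra.
Qed.

(** The convergence is only locally uniform, as the weight [w] may be unbounded; near [x] it is at
    most [w x + 1], and [n] is chosen to make the errors at [x] and at nearby points small
    together. *)
Lemma continuous_geometric_limit (f : R -> R) (g : nat -> R -> R) (w : R -> R) :
  (forall n, continuous (g n)) -> continuous w ->
  (forall n t, `|f t - g n t| <= 2^-1 ^+ n * w t) -> continuous f.
Proof.
move=> cg cw fg x; apply/cvgrPdist_lt => e e0.
have e2 : 0 < e / 2 by rewrite divr_gt0.
have [n hn] := half_expn_small (w x + (w x + 1)) e2.
have h1 : \forall t \near x, `|g n x - g n t| < e / 2.
  by have /cvgrPdist_lt := cg n x; apply.
have h2 : \forall t \near x, `|w x - w t| < 1.
  by have /cvgrPdist_lt := cw x; apply.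
near=> t.
have t1 : `|g n x - g n t| < e / 2 by near: t.
have t2 : w t <= w x + 1.
  have : `|w x - w t| < 1 by near: t.
  by rewrite ltr_norml => /andP[]; lra.
have t3 := fg n x; have t4 := fg n t.
have t5 : 2^-1 ^+ n * w t <= 2^-1 ^+ n * (w x + 1) by rewrite ler_pM2l// half_expn_gt0.
move: t1 t3 t4; rewrite ltr_norml !ler_norml ltr_norml => /andP[? ?] /andP[? ?] /andP[? ?].
by move: hn; rewrite mulrDr; lra.
Unshelve. all: by end_near. Qed.

Lemma vanishes_bounded (f : R -> R) a b : continuous f -> vanishes_outside a b f ->
  exists2 K, 0 <= K & forall x, `|f x| <= K.
Proof.
move=> cf f0; have [ab|ba] := leP a b; last first.
  by exists 0 => // x; rewrite f0 ?normr0//; apply/negP => /andP[]; lra.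
have cn : continuous (fun x => `|f x|).
  by move=> x; apply: cvg_norm; exact: cf.
have [c _ hc] := EVT_max ab (continuous_subspaceT cn).
exists `|f c| => // x; have [xab|xab] := boolP (a < x < b); last by rewrite f0// normr0.
by apply: hc; rewrite in_itv/=; case/andP: xab => *; rewrite !ltW.
Qed.

Lemma mulmx_entry_le n (A X : 'M[R]_n) K w i j :
  (forall k, `|A i k| <= K) -> (forall k, `|X k j| <= w) ->
  `|(A *m X) i j| <= n%:R * K * w.
Proof.
move=> hA hX; rewrite mxE (le_trans (ler_norm_sum _ _ _))//.
rewrite (@le_trans _ _ (\sum_(k < n) K * w))//.
  by apply: ler_sum => k _; rewrite normrM ler_pM.
by rewrite sumr_const card_ord mulr_natl mulrnAl.
Qed.

Lemma continuous_mulmx_entry n (A X : R -> 'M[R]_n) :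
  (forall i j, continuous (fun s => A s i j)) ->
  (forall i j, continuous (fun s => X s i j)) ->
  forall i j, continuous (fun s => (A s *m X s) i j).
Proof.
move=> cA cX i j.
rewrite (_ : (fun s => _) = (fun s => \sum_k A s i k * X s k j)); last first.
  by apply/funext => s; rewrite mxE.
move=> s; apply: cvg_big => [|k _]; first exact: add_continuous.
by apply: cvgM; [exact: cA|exact: cX].
Qed.

Arguments continuous_mulmx_entry {n A X} cA cX i j : rename.

Section Picard.
Context {n : nat} (A : R -> 'M[R]_n) (a b : R).
Hypothesis cA : forall i j, continuous (fun s => A s i j).
Hypothesis A0 : forall i j, vanishes_outside a b (fun s => A s i j).

(** The integral operator of the Cauchy problem with value [I] at minus infinity, which is also the
    value at [a] since [A] vanishes before. It is taken entrywise because [primitive] applies to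
    real functions. *)
Definition picard_step (X : R -> 'M[R]_n) (s : R) : 'M[R]_n :=
  1%:M + \matrix_(i, j) primitive (fun t => (A t *m X t) i j) s.

Lemma vanishes_mulmx (X : R -> 'M[R]_n) i j :
  vanishes_outside a b (fun s => (A s *m X s) i j).
Proof.
by move=> s sab; rewrite mxE big1// => k _; rewrite A0 ?mul0r.
Qed.

Lemma is_derive_picard_step (X : R -> 'M[R]_n) : (forall i j, continuous (fun s => X s i j)) ->
  forall i j (s : R), is_derive s 1 (fun s : R => picard_step X s i j) ((A s *m X s) i j).
Proof.
move=> cX i j s.
have d := is_derive_primitive (continuous_mulmx_entry cA cX i j) (vanishes_mulmx X i j) s.
have d' := is_deriveD (is_derive_cst ((1%:M : 'M[R]_n) i j) s 1) d.
rewrite (_ : (fun s => _) = cst ((1%:M : 'M[R]_n) i j) + primitive (fun t => (A t *m X t) i j)).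
  by apply: (is_derive_eq d'); rewrite add0r.
by apply/funext => t; rewrite !mxE.
Qed.
Arguments is_derive_picard_step {X} cX i j s : rename.

Lemma picard_step_left X s : s <= a -> picard_step X s = 1%:M.
Proof.
move=> sa; apply/matrixP => i j; rewrite !mxE.
by rewrite (primitive_left (vanishes_mulmx X i j) sa) addr0.
Qed.

Lemma picard_step_continuous (X : R -> 'M[R]_n) : (forall i j, continuous (fun s => X s i j)) ->
  forall i j, continuous (fun s => picard_step X s i j).
Proof. by move=> cX i j; apply: is_derive_continuous (is_derive_picard_step cX i j). Qed.

Definition picard m : R -> 'M[R]_n := iter m picard_step (fun=> 1%:M).

Lemma picard_continuous m i j : continuous (fun s => picard m s i j).
Proof.
elim: m i j => [|m ih]; first by move=> i j s; exact: cvg_cst.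
exact: picard_step_continuous.
Qed.

Lemma picard_left m s : s <= a -> picard m s = 1%:M.
Proof. by case: m => // m; exact: picard_step_left. Qed.

Lemma entries_bounded : exists2 K, 0 <= K & forall s i j, `|A s i j| <= K.
Proof.
have /choice[K hK] : forall p : 'I_n * 'I_n, exists K,
    0 <= K /\ forall s, `|A s p.1 p.2| <= K.
  by move=> [i j]; have [K ? ?] := vanishes_bounded (@cA i j) (@A0 i j); exists K.
exists (\sum_p K p); first by apply: sumr_ge0 => p _; have [] := hK p.
move=> s i j; rewrite (bigD1 (i, j))//=; have [_ h] := hK (i, j).
by rewrite (le_trans (h s))// lerDl sumr_ge0// => p _; have [] := hK p.
Qed.

Section Weight.
Context (L : R) (L0 : 0 < L).
(** [L] bounds the operator norm of every [A s] for the maximum norm of a column. *)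
Hypothesis AL : forall (X : 'M[R]_n) (w s : R) i j,
  (forall k, `|X k j| <= w) -> `|(A s *m X) i j| <= L * w.

(* The weight for which [X |-> \int A X] contracts by the factor 1/2. *)
Definition weight s := expR (2 * L * (s - a)).

Lemma weight_ge0 s : 0 <= weight s. Proof. exact: expR_ge0. Qed.

Lemma is_derive_weight c (s : R) :
  is_derive s 1 (fun s : R => c * weight s) (c * (2 * L) * weight s).
Proof.
have d1 : is_derive s 1 (fun s : R => 2 * L * (s - a)) (2 * L).
  by apply: is_derive_eq; rewrite subr0 scaler1.
have d2 : is_derive s 1 (expR \o (fun s => 2 * L * (s - a))) (weight s * (2 * L)).
  exact: is_derive1_comp.
have d3 := is_deriveZ c d2; apply: (is_derive_eq d3).
by rewrite /GRing.scale/=; ring.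
Qed.

(** The derivative of the difference is at most [L * (c * weight t)], which is exactly the
    derivative of [2^-1 * c * weight t]: the factor 2 in the exponent of the weight pays for the one
    half. *)
Lemma picard_step_contracts (X Y : R -> 'M[R]_n) c :
  (forall i j, continuous (fun s => X s i j)) ->
  (forall i j, continuous (fun s => Y s i j)) ->
  0 <= c -> (forall s i j, a <= s -> `|X s i j - Y s i j| <= c * weight s) ->
  forall s i j, a <= s ->
    `|picard_step X s i j - picard_step Y s i j| <= 2^-1 * c * weight s.
Proof.
move=> cX cY c0 XY s i j sa.
have dF (t : R) : is_derive t 1 (fun t : R => picard_step X t i j - picard_step Y t i j)
    ((A t *m X t) i j - (A t *m Y t) i j).
  exact: is_deriveB (is_derive_picard_step cX i j t) (is_derive_picard_step cY i j t).
apply: (is_derive_norm_le dF (is_derive_weight (2^-1 * c)) (a := a) (b := s)).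
- move=> t /andP[ta ts].
  rewrite (_ : _ - _ = (A t *m (X t - Y t)) i j); last by rewrite mulmxBr !mxE.
  rewrite (le_trans (AL _ _ (w := c * weight t) _))//.
    by move=> k; rewrite !mxE XY.
  lra.
- by rewrite !picard_step_left// subrr normr0 !mulr_ge0// ?weight_ge0// invr_ge0.
- by rewrite sa lexx.
Qed.

Lemma picard_diff m s i j : a <= s ->
  `|picard m.+1 s i j - picard m s i j| <= 2^-1 ^+ m * weight s.
Proof.
elim: m s i j => [|m ih] s i j sa.
  have cst1 : forall i j, continuous (fun s : R => (1%:M : 'M[R]_n) i j).
    by move=> ? ? ?; exact: cvg_cst.
  have dF (t : R) : is_derive t 1 (fun t : R => picard 1 t i j - picard 0 t i j) ((A t *m 1%:M) i j).
    have d0 := is_derive_picard_step cst1 i j t.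
    have d1 := is_deriveB d0 (is_derive_cst ((1%:M : 'M[R]_n) i j) t 1).
    by apply: (is_derive_eq d1); rewrite subr0.
  apply: (is_derive_norm_le dF (is_derive_weight _) (a := a) (b := s)).
  - move=> t /andP[ta _]; rewrite (le_trans (AL _ _ (w := 1) _))//.
      by move=> k; rewrite mxE; case: eqP; rewrite ?normr1 ?normr0.
    rewrite expr0 mul1r mulr1.
    have : 1 <= weight t.
      by rewrite -expR0 ler_expR !mulr_ge0 ?subr_ge0// ltW.
    move=> w1; apply: (@le_trans _ _ (2 * L * 1)); first by rewrite mulr1 ler_pMl// ler1n.
    by rewrite ler_pM2l// mulr_gt0.
  - by rewrite !picard_left// subrr normr0 mul1r weight_ge0.
  - by rewrite sa lexx.
rewrite exprS; apply: (@picard_step_contracts (picard m.+1) (picard m)) => //.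
- exact: picard_continuous.
- exact: picard_continuous.
Qed.

End Weight.

(** The weighted estimate holds on the whole half-line from [a], so the iterates converge everywhere
    at once and no local solutions have to be glued. Differentiability comes last, from the
    fixed-point equation. *)
Lemma linear_ode_exists : exists X : R -> 'M[R]_n,
  (forall i j (s : R), is_derive s 1 (fun s : R => X s i j) ((A s *m X s) i j)) /\
  (forall s, s <= a -> X s = 1%:M).
Proof.
have [K K0 hK] := entries_bounded.
(* An entry of [A *m X] has [n] terms, whence [n%:R * K]; the 1 makes [L] positive even when [K] is
   0. *)
pose L := n%:R * K + 1.
have L0 : 0 < L by rewrite ltr_wpDl// mulr_ge0.
have AL (X : 'M[R]_n) w s i j :
    (forall k, `|X k j| <= w) -> `|(A s *m X) i j| <= L * w.
  move=> Xw; have w0 : 0 <= w by apply: le_trans (Xw i).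
  rewrite (le_trans (mulmx_entry_le (hK s i) Xw))//.
  by rewrite ler_wpM2r// lerDl.
have /choice[X hX] : forall p : R * 'I_n * 'I_n, exists l, forall m,
    `|l - picard m p.1.1 p.1.2 p.2| <= 2^-1 ^+ m * (2 * weight L p.1.1).
  move=> [[s i] j] /=; apply: geometric_limit => m.
  have [sa|/ltW sa] := leP a s; first exact: picard_diff.
  by rewrite !picard_left// subrr normr0 mulr_ge0 ?weight_ge0// ltW// half_expn_gt0.
pose Y s := \matrix_(i, j) X (s, i, j).
have hY s i j m : `|Y s i j - picard m s i j| <= 2^-1 ^+ m * (2 * weight L s).
  by rewrite mxE; exact: hX.
have cw : continuous (fun s => 2 * weight L s).
  exact: is_derive_continuous (is_derive_weight L 2).
have cY i j : continuous (fun s => Y s i j).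
  apply: (continuous_geometric_limit (fun m => @picard_continuous m i j) cw).
  by move=> m t; exact: hY.
have Y1 s : s <= a -> Y s = 1%:M.
  move=> sa; apply/matrixP => i j; apply/eqP; rewrite -subr_eq0; apply/eqP.
  by apply: half_expn_eq0 => m; rewrite -(picard_left m sa); exact: hY.
(* [picard_step Y] is within a multiple of [2^-1 ^+ m] of [picard m.+1] by contraction, and [Y] is
   so by construction. *)
have YS s : picard_step Y s = Y s.
  have [sa|/ltW sa] := leP a s; last by rewrite picard_step_left// Y1.
  apply/matrixP => i j; apply/eqP; rewrite -subr_eq0; apply/eqP.
  apply: (half_expn_eq0 (C := 2 * weight L s)) => m.
  have h1 : `|picard_step Y s i j - picard m.+1 s i j| <= 2^-1 * (2 * 2^-1 ^+ m) * weight L s.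
    apply: (@picard_step_contracts L AL Y (picard m)) => //.
    - exact: picard_continuous.
    - by move=> t k l _; rewrite (mulrC 2) -mulrA; exact: hY.
  rewrite (le_trans (ler_distD (picard m.+1 s i j) _ _))//.
  have h2 := hY s i j m.+1; rewrite distrC in h2.
  apply: (le_trans (lerD h1 h2)).
  rewrite (half_expnS m); move: (_ ^+ m.+1) (weight L s) => p w.
  rewrite (_ : 2^-1 * _ * w = 2 * p * w); last by rewrite (mulrA 2^-1) mulVf// mul1r.
  by lra.
exists Y; split => // i j s.
have <- : (fun s => picard_step Y s i j) = (fun s => Y s i j).
  by apply/funext => t; rewrite YS.
exact: is_derive_picard_step.
Qed.

End Picard.
End Existence.

(** * The moment problem for compactly supported continuous functions *)

Section Moments.
Context {R : realType}.
Implicit Types (f g : R -> R) (a b x : R).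
Local Notation mu := (@lebesgue_measure R).

Lemma ler_sqr_norm (x y : R) : `|x| <= y -> x ^+ 2 <= y ^+ 2.
Proof. by rewrite ler_norml => /andP[]; nra. Qed.

Lemma norm_ler_sqr (x y : R) : 0 <= y -> y <= `|x| -> y ^+ 2 <= x ^+ 2.
Proof. by move=> y0; rewrite ler_normr => /orP[]; nra. Qed.

Lemma is_derive_ge F f m a b : (forall x : R, is_derive x (1 : R) F (f x : R)) ->
  (forall y, a <= y <= b -> m <= f y) -> a <= b -> m * (b - a) <= F b - F a.
Proof.
move=> dF fm ab.
have [|c] := @MVT_segment R F f a b ab (fun y _ => dF y).
  by apply: continuous_subspaceT; apply: is_derive_continuous dF.
by rewrite in_itv/= => /fm ? ->; rewrite ler_wpM2r// subr_ge0.
Qed.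

Lemma continuous_mul f g : continuous f -> continuous g -> continuous (fun x => f x * g x).
Proof. by move=> cf cg x; apply: cvgM; [exact: cf|exact: cg]. Qed.

Lemma continuous_expn k : continuous (fun x : R => x ^+ k).
Proof. exact: exprn_continuous. Qed.

Lemma vanishes_mull a b f g : vanishes_outside a b g -> vanishes_outside a b (fun x => f x * g x).
Proof. by move=> g0 x /g0 ->; rewrite mulr0. Qed.

Lemma Rintegral_horner_eq0 a b f : continuous f -> vanishes_outside a b f ->
  (forall k, \int[mu]_x (x ^+ k * f x) = 0) ->
  forall p : {poly R}, \int[mu]_x (p.[x] * f x) = 0.
Proof.
move=> cf f0 mf p.
have int g : continuous g -> mu.-integrable setT (EFin \o (fun x => g x * f x)).
  by move=> cg; apply: (@vanishes_integrable _ a b); [exact: continuous_mul|exact: vanishes_mull].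
(* The factor [x ^+ k] carries the induction on [p]: splitting off ['X] raises [k]. *)
suff H k : \int[mu]_x (x ^+ k * p.[x] * f x) = 0.
  by rewrite -[RHS](H 0%N); apply: eq_Rintegral => x _; rewrite expr0 mul1r.
elim/poly_ind: p k => [|p c ih] k.
  rewrite (@eq_Rintegral _ _ _ mu _ (cst 0)) ?Rintegral_cst ?mul0r// => x _.
  by rewrite horner0 mulr0 mul0r.
rewrite (@eq_Rintegral _ _ _ mu _ (fun x => x ^+ k.+1 * p.[x] * f x + c * (x ^+ k * f x))).
  rewrite RintegralD//.
  - by rewrite ih add0r RintegralZl// ?mf ?mulr0//; apply: int; exact: continuous_expn.
  - by apply: int; apply: continuous_mul; [exact: continuous_expn|exact: continuous_horner].
  - under [X in _.-integrable _ (EFin \o X)]eq_fun => x do rewrite mulrA.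
    apply: int; apply: continuous_mul; [by move=> ?; exact: cvg_cst|exact: continuous_expn].
by move=> x _; rewrite hornerMXaddC exprS; ring.
Qed.

(* Powers of a parabola that exceeds 1 exactly near a point where [f] is positive would have unbounded integral against [f]. *)
Lemma moments_eq0_le0 a b f : continuous f -> vanishes_outside a b f ->
  (forall k, \int[mu]_x (x ^+ k * f x) = 0) -> forall x, f x <= 0.
Proof.
move=> cf f0 mf x0; rewrite leNgt; apply/negP => fx0.
have [d d0 hd] : exists2 d, 0 < d & forall x, `|x0 - x| < d -> f x0 / 2 < f x.
  have e0 : 0 < f x0 / 2 by rewrite divr_gt0.
  have /cvgrPdist_lt/(_ _ e0)[d d0 hd] := cf x0.
  exists d => // x /hd/=; rewrite ltr_norml => /andP[]; lra.
have [C C0 hC] := vanishes_bounded cf f0.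
have inab x : `|x0 - x| < d -> a < x < b.
  move=> xd; apply/negPn/negP => /f0 fx; have := hd _ xd; rewrite fx; lra.
have d2 x : `|x0 - x| <= d / 2 -> `|x0 - x| < d by move=> /le_lt_trans; apply; lra.
have /andP[ax0 x0b] : a < x0 < b by apply: inab; rewrite subrr normr0.
have /andP[ad _] : a < x0 - d / 2 < b.
  by apply/inab/d2; rewrite opprB addrC subrK ger0_norm//; lra.
have /andP[_ db] : a < x0 + d / 2 < b.
  by apply/inab/d2; rewrite opprD addrA subrr add0r normrN ger0_norm//; lra.
pose L := b - a; have L0 : 0 < L by rewrite subr_gt0 (lt_trans ax0).
have normL x : `|(x - x0) / L| = `|x0 - x| / L.
  by rewrite normrM distrC (ger0_norm (x := L^-1))// invr_ge0 ltW.
(* With this [h] the parabola [q] equals 1 at distance [d] from [x0], is at least [1 + 3 / 4 * h]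
   within [d / 2], and is nonnegative on [[a, b]], where [|x - x0| <= L]. *)
pose h := (d / L) ^+ 2; have h0 : 0 < h by rewrite exprn_gt0// divr_gt0.
pose q : {poly R} := (1 + h)%:P - (L^-1%:P * ('X - x0%:P)) ^+ 2.
have qE x : q.[x] = 1 + h - ((x - x0) / L) ^+ 2.
  by rewrite /q !hornerE/= (mulrC L^-1).
pose y := 1 + 3 / 4 * h.
have y1 : 1 < y by rewrite ltrDl mulr_gt0// divr_gt0.
have q_in x : `|x0 - x| <= d / 2 -> y <= q.[x].
  move=> xd; rewrite qE /y.
  have : ((x - x0) / L) ^+ 2 <= (d / 2 / L) ^+ 2.
    by rewrite ler_sqr_norm// normL ler_wpM2r// invr_ge0 ltW.
  have -> : (d / 2 / L) ^+ 2 = h / 4 by rewrite /h; field; rewrite gt_eqF.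
  lra.
have q_ge0 x : a <= x <= b -> 0 <= q.[x].
  move=> xab; rewrite qE.
  have : ((x - x0) / L) ^+ 2 <= 1.
    rewrite -[leRHS](expr1n _ 2) ler_sqr_norm// normL.
    by rewrite ler_pdivrMr// mul1r ler_norml /L; case/andP: xab => *; lra.
  lra.
have q_out x : d <= `|x0 - x| -> q.[x] <= 1.
  move=> xd; rewrite qE.
  have : h <= ((x - x0) / L) ^+ 2.
    apply: norm_ler_sqr; first by rewrite divr_ge0// ltW.
    by rewrite normL ler_wpM2r// invr_ge0 ltW.
  lra.
(* The middle interval, of length [d], contributes at least [y ^+ n * (f x0 / 2) * d], and the rest
   at least [- C * (L - d)]. This [n] makes the gain exceed [C * L], against a total of 0. *)
have [||n hn] := @expn_small _ y^-1 (C * L) (f x0 / 2 * d).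
- by rewrite invr_gt0 invf_lt1 ?y1 ?andbT; lra.
- by rewrite mulr_gt0// divr_gt0.
pose g x := (q ^+ n).[x] * f x.
have gE x : g x = q.[x] ^+ n * f x by rewrite /g horner_exp.
have cg : continuous g by apply: continuous_mul => //; exact: continuous_horner.
have g0 : vanishes_outside a b g by exact: vanishes_mull.
have dP := is_derive_primitive cg g0.
have Ig : primitive g b - primitive g a = 0.
  by rewrite -(Rintegral_is_derive cg g0 dP); exact: (Rintegral_horner_eq0 cf f0 mf).
(* Closer than [d] to [x0] both factors are nonnegative; farther away the power of [q] lies between
   0 and 1. *)
have gC x : a <= x <= b -> - C <= g x.
  move=> xab; rewrite gE; have [xd|xd] := ltP `|x0 - x| d.
    rewrite (@le_trans _ _ 0) ?oppr_le0// mulr_ge0 ?exprn_ge0 ?q_ge0//.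
    by have := hd _ xd; lra.
  have := hC x; rewrite ler_norml => /andP[fC _].
  have q0 := q_ge0 _ xab; have q1 := q_out _ xd.
  have e1 : q.[x] ^+ n <= 1 by rewrite exprn_ile1.
  have e0 : 0 <= q.[x] ^+ n by rewrite exprn_ge0.
  by nra.
have gy x : x0 - d / 2 <= x <= x0 + d / 2 -> y ^+ n * (f x0 / 2) <= g x.
  move=> xd; have xd' : `|x0 - x| <= d / 2 by rewrite ler_norml; lra.
  have xab : a <= x <= b by lra.
  have y0 : 0 <= y by rewrite ltW// (lt_trans ltr01).
  rewrite gE ler_pM ?exprn_ge0//.
  - by rewrite divr_ge0// ltW.
  - by apply: lerXn2r; rewrite ?nnegrE ?q_ge0 ?q_in.
  - by apply/ltW/hd/d2.
have s1 : - C * (x0 - d / 2 - a) <= primitive g (x0 - d / 2) - primitive g a.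
  apply: (is_derive_ge dP); last by lra.
  by move=> x xab; apply: gC; lra.
have s2 : y ^+ n * (f x0 / 2) * (x0 + d / 2 - (x0 - d / 2)) <=
    primitive g (x0 + d / 2) - primitive g (x0 - d / 2).
  by apply: (is_derive_ge dP); [exact: gy|lra].
have s3 : - C * (b - (x0 + d / 2)) <= primitive g b - primitive g (x0 + d / 2).
  apply: (is_derive_ge dP); last by lra.
  by move=> x xab; apply: gC; lra.
have yn : 0 < y ^+ n by rewrite exprn_gt0//; lra.
move: hn; rewrite exprVn mulrC ltr_pdivrMr// /L => hn.
have Cd : 0 <= C * d by rewrite mulr_ge0// ltW.
by nra.
Qed.

Lemma moments_eq0 a b f : continuous f -> vanishes_outside a b f ->
  (forall k, \int[mu]_x (x ^+ k * f x) = 0) -> forall x, f x = 0.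
Proof.
move=> cf f0 mf x; apply/eqP; rewrite eq_le (moments_eq0_le0 cf f0 mf)/=.
rewrite -oppr_le0; apply: (@moments_eq0_le0 a b (fun x => - f x)).
- by move=> z; apply: cvgN; exact: cf.
- by move=> z /f0 ->; rewrite oppr0.
move=> k; rewrite (@eq_Rintegral _ _ _ mu _ (fun x => -1 * (x ^+ k * f x))).
  rewrite RintegralZl// ?mf ?mulr0//.
  apply: (@vanishes_integrable _ a b); last exact: vanishes_mull.
  by apply: continuous_mul => //; exact: continuous_expn.
by move=> z _; rewrite mulN1r mulrN.
Qed.

End Moments.

(** * Iterated integrals, and functions of two variables with zero line integrals *)

Section Fubini.
Context {R : realType}.
Local Notation mu := (@lebesgue_measure R).

Lemma integrable_indic (c d C : R) :
  mu.-integrable setT (EFin \o (cst C \_ `[c, d])).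
Proof.
rewrite -restrict_EFin; apply/integrable_restrict => //=; rewrite setTI.
apply: continuous_compact_integrable; first exact: segment_compact.
by apply: continuous_subspaceT => x; exact: cvg_cst.
Qed.

Lemma vanishes_norm_le (c d C : R) (f : R -> R) : vanishes_outside c d f ->
  (forall y, `|f y| <= C) -> forall y, `|f y| <= (cst C \_ `[c, d]) y.
Proof.
move=> f0 fC y; rewrite patchE; case: ifPn => // ycd.
rewrite f0 ?normr0//; apply: contra ycd => /andP[? ?].
by rewrite inE/= in_itv/= !ltW.
Qed.

Section Box.
Context (f : R -> R -> R) (a b c d C : R).
Hypothesis cf1 : forall y, continuous (f ^~ y).
Hypothesis cf2 : forall x, continuous (f x).
Hypothesis fC : forall x y, `|f x y| <= C.
Hypothesis f01 : forall y, vanishes_outside a b (f ^~ y).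
Hypothesis f02 : forall x, vanishes_outside c d (f x).

(** Dominated convergence with majorant [C] on [[c, d]]. The domain is left free because both the
    whole line and the half-lines of [primitive] occur. *)
Lemma continuous_Rintegral (D : set R) : measurable D ->
  continuous (fun x => \int[mu]_(y in D) f x y).
Proof.
move=> mD x.
apply: (@continuity_under_integral R _ _ mu f D mD (x - 1) (x + 1) _ _ (cst C \_ `[c, d])).
- move=> z _; apply: integrableS (vanishes_integrable (@cf2 z) (@f02 z)) => //.
- by apply: aeW => y _ z _; exact: cf1.
- by apply: integrableS (integrable_indic c d C).
- by move=> z _; apply: aeW => y _; exact: vanishes_norm_le.
- by rewrite inE/= in_itv/=; apply/andP; split; lra.
Qed.

End Box.

(* Both iterated integrals, with upper limit [T] in [x], have the same derivative in [T]. *)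
Lemma Rintegral_swap (f : R -> R -> R) (a b c d C : R) :
  (forall y, continuous (f ^~ y)) -> (forall x, continuous (f x)) ->
  (forall x y, `|f x y| <= C) ->
  (forall y, vanishes_outside a b (f ^~ y)) -> (forall x, vanishes_outside c d (f x)) ->
  \int[mu]_x \int[mu]_y f x y = \int[mu]_y \int[mu]_x f x y.
Proof.
move=> cf1 cf2 fC f01 f02.
pose F T y := primitive (f ^~ y) T.
have dF y T : is_derive T (1 : R) (F ^~ y) (f T y).
  exact: (is_derive_primitive (cf1 y) (f01 y)).
have F0 T : vanishes_outside c d (F T).
  move=> y ycd; rewrite /F /primitive (@eq_Rintegral _ _ _ mu _ (cst 0)) ?Rintegral_cst ?mul0r//.
  by move=> x _; exact: f02.
have cF T : continuous (F T).
  exact: (continuous_Rintegral cf2 cf1 (fun y x => fC x y) f01).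
pose H T := \int[mu]_y F T y.
have dH T : is_derive T (1 : R) H (\int[mu]_y f T y).
  have T1 : T \in `]T - 1, T + 1[ by rewrite in_itv/=; apply/andP; split; lra.
  have intF x : x \in `]T - 1, T + 1[ -> mu.-integrable setT (EFin \o F x).
    by move=> _; exact: vanishes_integrable (cF x) (F0 x).
  have derF x y : x \in `]T - 1, T + 1[ -> setT y -> derivable (F ^~ y) x 1.
    by move=> _ _; have [] := dF y x.
  have C0 : 0 <= C by apply: le_trans (fC 0 0).
  have G0 y : 0 <= (cst C \_ `[c, d]) y by rewrite patchE; case: ifP.
  have E x y : partial1of2 F x y = f x y.
    by rewrite partial1of2E; have [] := dF y x.
  have GF x y : x \in `]T - 1, T + 1[ -> setT y -> `|partial1of2 F x y| <= (cst C \_ `[c, d]) y.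
    by move=> _ _; rewrite E; exact: vanishes_norm_le.
  have D := @derivable_under_integral _ _ _ mu F setT measurableT T (T - 1) (T + 1) T1
    intF derF _ G0 (integrable_indic c d C) GF.
  have D' := @differentiation_under_integral _ _ _ mu F setT measurableT T (T - 1) (T + 1) T1
    intF derF _ G0 (integrable_indic c d C) GF.
  apply: DeriveDef => //; rewrite -derive1E D'; apply: eq_Rintegral => y _; exact: E.
have cI := continuous_Rintegral cf1 cf2 fC f02 measurableT.
have I0 : vanishes_outside a b (fun x => \int[mu]_y f x y).
  move=> x xab; rewrite (@eq_Rintegral _ _ _ mu _ (cst 0)) ?Rintegral_cst ?mul0r//.
  by move=> y _; exact: f01.
rewrite (Rintegral_is_derive cI I0 dH).
have -> : H a = 0.
  rewrite /H (@eq_Rintegral _ _ _ mu _ (cst 0)) ?Rintegral_cst ?mul0r// => y _.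
  exact: (primitive_left (f01 y)).
rewrite subr0; apply: eq_Rintegral => y _; exact: (primitive_right (f01 y)).
Qed.

Lemma Rintegral_sum_vanishes n (g : 'I_n -> R -> R) (a b : R) :
  (forall i, continuous (g i)) -> (forall i, vanishes_outside a b (g i)) ->
  \int[mu]_x (\sum_(i < n) g i x) = \sum_(i < n) \int[mu]_x g i x.
Proof.
elim: n g => [|n ih] g cg g0.
  rewrite big_ord0 (@eq_Rintegral _ _ _ mu _ (cst 0)) ?Rintegral_cst ?mul0r// => x _.
  by rewrite big_ord0.
rewrite big_ord_recr/= -ih// -RintegralD//.
- by apply: eq_Rintegral => x _; rewrite big_ord_recr.
- apply: (@vanishes_integrable _ a b); last by move=> x xab; rewrite big1// => i _; exact: g0.
  move=> x; apply: cvg_big => [|i _]; [exact: add_continuous|exact: cg].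
- exact: (@vanishes_integrable _ a b).
Qed.

Lemma polynomial_coef_eq0 n (m : 'I_n -> R) :
  (forall a, \sum_(i < n) m i * a ^+ i = 0) -> forall i, m i = 0.
Proof.
move=> h; case: n m h => [m _ []//|n m h i].
pose p : {poly R} := \poly_(k < n.+1) m (inord k).
have pE a : p.[a] = 0.
  rewrite horner_poly -[RHS](h a); apply: eq_bigr => k _.
  by rewrite inord_val.
have p0 : p = 0.
  apply/eqP/negPn/negP => p0.
  (* The first [size p] natural numbers are distinct roots, one more than the degree allows. *)
  have := @max_poly_roots _ p [seq k%:R | k <- iota 0 (size p)] p0.
  rewrite size_map size_iota ltnn => /(_ _ _)/notF; apply.
    by apply/allP => _ /mapP[k _ ->]; rewrite rootE pE.
  by rewrite map_inj_uniq ?iota_uniq//; exact: mulrIn (oner_neq0 _).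
have : p`_i = 0 by rewrite p0 coef0.
by rewrite /p coef_poly ltn_ord inord_val.
Qed.


(* A family of lines [y = s x + t] suffices: integrating [t ^ k] against the line integrals gives
   [\int\int (y - s x) ^ k h x y = 0], a polynomial identity in [s], so all the moments of [h] vanish. *)
Lemma planar_lines_injective (h : R -> R -> R) (M C : R) :
  (forall x y u w, continuous (fun s : R => h (x + s * u) (y + s * w))) ->
  (forall x y, `|h x y| <= C) ->
  (forall x y, ~~ (- M < x < M) -> h x y = 0) ->
  (forall x y, ~~ (- M < y < M) -> h x y = 0) ->
  (forall s t, \int[mu]_x h x (s * x + t) = 0) ->
  forall x y, h x y = 0.
Proof.
move=> hc hC h01 h02 hI.
have ch1 y : continuous (h ^~ y).
  rewrite (_ : h ^~ y = fun s : R => h (0 + s * 1) (y + s * 0)); first exact: hc.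
  by apply/funext => s; rewrite mulr0 mulr1 add0r addr0.
have ch2 x : continuous (h x).
  rewrite (_ : h x = fun s : R => h (x + s * 0) (0 + s * 1)); first exact: hc.
  by apply/funext => s; rewrite mulr0 mulr1 add0r addr0.
have C0 : 0 <= C by apply: le_trans (hC 0 0).
have pow_bound k (N y u : R) : (~~ (- N < y < N) -> u = 0) -> `|u| <= C ->
    `|y ^+ k * u| <= `|N| ^+ k * C.
  move=> yN uC; have [yy|/yN ->] := boolP (- N < y < N); last first.
    by rewrite mulr0 normr0 mulr_ge0// exprn_ge0.
  rewrite normrM normrX ler_pM ?exprn_ge0//; apply: lerXn2r; rewrite ?nnegrE//.
  by rewrite (le_trans _ (ler_norm N))// ler_norml; case/andP: yy => *; lra.
(* After the substitution [t = y - s * x] and an exchange of integrals, the inner integral is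
   [t ^+ k] times the integral of [h] along the line [y = s * x + t]. *)
have shear k s : \int[mu]_x \int[mu]_y ((y - s * x) ^+ k * h x y) = 0.
  pose f x t := t ^+ k * h x (s * x + t).
  have fE x : \int[mu]_y ((y - s * x) ^+ k * h x y) = \int[mu]_t f x t.
    have cg : continuous (fun y : R => (y - s * x) ^+ k * h x y).
      apply: continuous_mul => //.
      move=> y; apply: (@cvg_comp _ _ _ (fun y : R => y - s * x) (fun z : R => z ^+ k)).
        by apply: cvgB; [exact: cvg_id|exact: cvg_cst].
      exact: continuous_expn.
    have := Rintegral_affine (s * x) ltr01 cg (vanishes_mull _ (h02 x)).
    rewrite invr1 mul1r => <-; apply: eq_Rintegral => t _.
    by rewrite /f mul1r addrK (addrC t).
  rewrite (@eq_Rintegral _ _ _ mu _ (fun x => \int[mu]_t f x t)); last by move=> x _.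
  (* The shear maps the square [|x| < M], [|y| < M] into the strip [|t| < N]. *)
  pose N := M + `|s| * M.
  have fN x t : ~~ (- N < t < N) -> h x (s * x + t) = 0.
    move=> tN; have [xM|/h01->//] := boolP (- M < x < M).
    apply: h02; apply: contra tN => /andP[y1 y2].
    have : `|s * x| <= `|s| * M.
      by rewrite normrM ler_wpM2l// ler_norml; case/andP: xM => *; lra.
    by rewrite ler_norml => /andP[]; rewrite /N; lra.
  rewrite (@Rintegral_swap f (- M) M (- N) N (`|N| ^+ k * C)).
  - rewrite (@eq_Rintegral _ _ _ mu _ (cst 0)) ?Rintegral_cst ?mul0r// => t _.
    rewrite RintegralZl ?hI ?mulr0//; apply: (@vanishes_integrable _ (- M) M); last first.
      by move=> x /h01.
    rewrite (_ : (fun x => _) = fun x : R => h (0 + x * 1) (t + x * s)); first exact: hc.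
    by apply/funext => x; rewrite mulr1 add0r addrC mulrC.
  - move=> t; apply: continuous_mul; first by move=> ?; exact: cvg_cst.
    rewrite (_ : (fun x => _) = fun x : R => h (0 + x * 1) (t + x * s)); first exact: hc.
    by apply/funext => x; rewrite mulr1 add0r addrC mulrC.
  - move=> x; apply: continuous_mul; first exact: continuous_expn.
    rewrite (_ : (fun t => _) = fun t : R => h (x + t * 0) (s * x + t * 1)); first exact: hc.
    by apply/funext => t; rewrite mulr1 mulr0 addr0.
  - by move=> x t; apply: pow_bound => //; exact: fN.
  - by move=> t x xM; rewrite /f h01// mulr0.
  - by move=> x t tN; rewrite /f fN// mulr0.
pose phi j x := \int[mu]_y (y ^+ j * h x y).
have cphi j : continuous (phi j).
  apply: (@continuous_Rintegral (fun x y => y ^+ j * h x y) (- M) M (`|M| ^+ j * C)) => //.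
  - by move=> y; apply: continuous_mul => // ?; exact: cvg_cst.
  - by move=> x; apply: continuous_mul => //; exact: continuous_expn.
  - by move=> x y; apply: pow_bound => //; exact: h02.
  - by move=> x y yM; rewrite h02// mulr0.
have phi0 j : vanishes_outside (- M) M (phi j).
  move=> x xM; rewrite /phi (@eq_Rintegral _ _ _ mu _ (cst 0)) ?Rintegral_cst ?mul0r// => y _.
  by rewrite h01// mulr0.
have moments i j : \int[mu]_x (x ^+ i * phi j x) = 0.
  pose k := (i + j)%N.
  (* The coefficient of [s ^+ l] in the binomial expansion of the integral in [shear k s]. For
     [l = i] it is the wanted moment times a nonzero signed binomial coefficient. *)
  pose c (l : 'I_k.+1) := (-1) ^+ l *+ 'C(k, l) * \int[mu]_x (x ^+ l * phi (k - l)%N x).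
  have ik : (i < k.+1)%N by rewrite ltnS leq_addr.
  have c0 : forall l, c l = 0.
    apply: polynomial_coef_eq0 => s; rewrite -[RHS](shear k s).
    have inner x : \int[mu]_y ((y - s * x) ^+ k * h x y) =
        \sum_(l < k.+1) (- s) ^+ l *+ 'C(k, l) * (x ^+ l * phi (k - l)%N x).
      rewrite (@eq_Rintegral _ _ _ mu _ (fun y => \sum_(l < k.+1)
          ((- s * x) ^+ l *+ 'C(k, l)) * (y ^+ (k - l) * h x y))); last first.
        move=> y _; rewrite -mulNr exprDn mulr_suml; apply: eq_bigr => l _.
        by rewrite -mulrnAr mulrA (mulrC (y ^+ _)).
      have cl (l : 'I_k.+1) : continuous (fun y : R => y ^+ (k - l) * h x y).
        by apply: continuous_mul => //; exact: continuous_expn.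
      have vl (l : 'I_k.+1) : vanishes_outside (- M) M (fun y : R => y ^+ (k - l) * h x y).
        by move=> y /h02 ->; rewrite mulr0.
      rewrite (@Rintegral_sum_vanishes _ _ (- M) M).
      - apply: eq_bigr => l _; rewrite RintegralZl//; last exact: vanishes_integrable (cl l) (vl l).
        by rewrite exprMn -mulrnAl -!mulrA.
      - by move=> l; apply: continuous_mul => // ?; exact: cvg_cst.
      - by move=> l x' /vl /= ->; rewrite mulr0.
    under [RHS]eq_Rintegral do rewrite inner.
    have cl (l : 'I_k.+1) : continuous (fun x : R => x ^+ l * phi (k - l)%N x).
      by apply: continuous_mul => //; exact: continuous_expn.
    have vl (l : 'I_k.+1) : vanishes_outside (- M) M (fun x => x ^+ l * phi (k - l)%N x).
      by move=> x /phi0 ->; rewrite mulr0.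
    rewrite (@Rintegral_sum_vanishes _ _ (- M) M).
    - apply: eq_bigr => l _; rewrite RintegralZl//; last exact: vanishes_integrable (cl l) (vl l).
      by rewrite /c mulrAC; congr (_ * _); rewrite (exprNn s) mulrnAl.
    - by move=> l; apply: continuous_mul => // ?; exact: cvg_cst.
    - by move=> l x' /vl /= ->; rewrite mulr0.
  have := c0 (Ordinal ik); rewrite /c/= addKn => /eqP.
  rewrite mulf_eq0 -mulr_natr mulf_eq0 signr_eq0/= pnatr_eq0.
  by rewrite -leqn0 leqNgt bin_gt0 leq_addr/= => /eqP.
(* The one-variable moment theorem serves twice: in [y] for fixed [x], and in [x] to show that each
   [phi j] is zero. *)
move=> x; apply: (moments_eq0 (ch2 x) (h02 x)) => j.
exact: (moments_eq0 (cphi j) (phi0 j) (fun i => moments i j)).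
Qed.

End Fubini.

(** * The matrix equation along a single line *)

Section LineODE.
Context {R : realType}.
Local Notation mu := (@lebesgue_measure R).

Lemma is_derive_mxP m n (X : R -> 'M[R]_(m, n)) (s : R) D :
  is_derive s (1 : R) X D <-> forall i j, is_derive s (1 : R) (fun s => X s i j) (D i j).
Proof.
split=> [[dX <-] i j|dX].
  apply: DeriveDef; first exact: (derivable_mxP _ _ _).1.
  by rewrite (derive_mx dX) mxE.
have dX' : derivable X s 1 by apply/derivable_mxP => i j; have [] := dX i j.
apply: DeriveDef => //; rewrite (derive_mx dX'); apply/matrixP => i j.
by rewrite mxE; have [] := dX i j.
Qed.

Lemma Hmx_skew (b : 'cV[R]_3) i j : Hmx b i j = - Hmx b j i.
Proof.
by case: i => [[|[|[|//]]] ?]; case: j => [[|[|[|//]]] ?]; rewrite !mxE/= ?opprK ?oppr0.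
Qed.

Lemma Hmx_cyclic (b : 'cV[R]_3) (i : 'I_3) : Hmx b i (i + 1) = b (i + 2%:R) 0.
Proof.
by case: i => [[|[|[|//]]] ?]; rewrite !mxE/=; congr (b _ _); apply: val_inj.
Qed.

Lemma HmxZ (t : R) b : Hmx (t *: b) = t *: Hmx b.
Proof.
apply/matrixP => i j.
by case: i => [[|[|[|//]]] ?]; case: j => [[|[|[|//]]] ?]; rewrite !mxE/= ?mulr0 ?mulrN.
Qed.

(** One description of all nine entries, from which continuity, support and size of the generator
    are read off the components of the field. *)
Lemma Hmx_entry (i j : 'I_3) : exists (r : R) k, `|r| <= 1 /\ forall b, Hmx b i j = r * b k 0.
Proof.
case: i => [[|[|[|//]]] ?]; case: j => [[|[|[|//]]] ?].
- by exists 0, 0; split => [|b]; rewrite ?normr0// !mxE/= mul0r.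
- by exists 1, 2%:R; split => [|b]; rewrite ?normr1// !mxE/= mul1r.
- by exists (-1), 1; split => [|b]; rewrite ?normrN1// !mxE/= mulN1r.
- by exists (-1), 2%:R; split => [|b]; rewrite ?normrN1// !mxE/= mulN1r.
- by exists 0, 0; split => [|b]; rewrite ?normr0// !mxE/= mul0r.
- by exists 1, 0; split => [|b]; rewrite ?normr1// !mxE/= mul1r.
- by exists 1, 1; split => [|b]; rewrite ?normr1// !mxE/= mul1r.
- by exists (-1), 0; split => [|b]; rewrite ?normrN1// !mxE/= mulN1r.
- by exists 0, 0; split => [|b]; rewrite ?normr0// !mxE/= mul0r.
Qed.

(** The squared Euclidean length of column [j], the quantity conserved under a skew-symmetric
    generator. *)
Definition colsq n (X : 'M[R]_n) j := \sum_i X i j * X i j.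

Lemma colsq_eq0 n (X : 'M[R]_n) : (forall j, colsq X j = 0) -> X = 0.
Proof.
move=> X0; apply/matrixP => i j; rewrite mxE; apply/eqP.
have /eqP := X0 j; rewrite psumr_eq0 => [/allP/(_ i (mem_index_enum _))|k _].
  by rewrite mulf_eq0 orbb.
by rewrite -expr2 sqr_ge0.
Qed.

Lemma le_colsq n (X : 'M[R]_n) i j : X i j ^+ 2 <= colsq X j.
Proof.
rewrite /colsq (bigD1 i)//= -expr2 lerDl sumr_ge0// => k _.
by rewrite -expr2 sqr_ge0.
Qed.

Lemma colsq1 n j : colsq (1%:M : 'M[R]_n) j = 1.
Proof.
rewrite /colsq (bigD1 j)//= mxE eqxx mulr1 big1 ?addr0// => k kj.
by rewrite mxE (negbTE kj) mulr0.
Qed.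

(** Exchanging the two summation indices changes the sign of the quadratic form of a skew-symmetric
    matrix. *)
Lemma skew_colsq n (A X : 'M[R]_n) j : (forall i k, A i k = - A k i) ->
  \sum_i X i j * (A *m X) i j = 0.
Proof.
move=> skA; set S := LHS.
suff : S = - S by lra.
have SE : S = \sum_i \sum_k X i j * (A i k * X k j).
  by apply: eq_bigr => i _; rewrite mxE mulr_sumr.
rewrite {1}SE exchange_big/= SE -sumrN; apply: eq_bigr => k _.
rewrite -sumrN; apply: eq_bigr => i _.
by rewrite (skA i k); ring.
Qed.

Lemma colsq_constant n (A X : R -> 'M[R]_n) : (forall s i k, A s i k = - A s k i) ->
  (forall i j (s : R), is_derive s (1 : R) (fun s => X s i j) ((A s *m X s) i j)) ->
  forall j s t, colsq (X s) j = colsq (X t) j.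
Proof.
move=> skA dX j.
have dC (s : R) : is_derive s (1 : R) (fun s => colsq (X s) j) 0.
  have d1 i : is_derive s (1 : R) ((fun s => X s i j) * (fun s => X s i j))
      (X s i j * (A s *m X s) i j + X s i j * (A s *m X s) i j).
    exact: is_deriveM.
  have d2 := is_derive_sum d1.
  rewrite (_ : (fun s => _) = \sum_i ((fun s => X s i j) * (fun s => X s i j))).
    by apply: (is_derive_eq d2); rewrite big_split/= skew_colsq// addr0.
  by apply/funext => t; rewrite fct_sumE.
have mono s t : s <= t -> colsq (X s) j = colsq (X t) j.
  by move=> st; apply: (is_derive0_eq dC).
by move=> s t; have [/mono|/ltW/mono] := leP s t.
Qed.

Lemma cvg_entry {T : Type} (F : set_system T) {FF : Filter F} (X : T -> 'M[R]_3) (l : 'M[R]_3) i j :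
  X x @[x --> F] --> l -> X x i j @[x --> F] --> (l i j : R).
Proof.
move=> Xl; apply: (cvg_comp _ (fun M : 'M[R]_3 => M i j) Xl).
exact: coord_continuous.
Qed.

Lemma cvg_colsq {T : Type} (F : set_system T) {FF : Filter F} (X : T -> 'M[R]_3) (l : 'M[R]_3) j :
  X x @[x --> F] --> l -> colsq (X x) j @[x --> F] --> (colsq l j : R).
Proof.
move=> Xl; apply: cvg_big => [|i _]; first exact: add_continuous.
by apply: cvgM; exact: cvg_entry.
Qed.

(** Used to read a conserved quantity off its limit at minus infinity. *)
Lemma cvg_cst_inv {T : Type} (F : set_system T) {FF : ProperFilter F} (k l : R) :
  k @[_ --> F] --> l -> k = l.
Proof.
move=> h; rewrite -(cvg_lim (@norm_hausdorff _ _) h); apply/esym/lim_cst.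
exact: norm_hausdorff.
Qed.

(** The conditions of [is_Sigma] on one line, with [beta] the field along the line and [c] in place
    of [gammaN / v]. *)
Definition line_solution (c : R) (beta : R -> 'cV[R]_3) (X : R -> 'M[R]_3) :=
  (forall s : R, is_derive s (1 : R) X (c *: (Hmx (beta s) *m X s))) /\
  (X s @[s --> -oo] --> (1%:M : 'M[R]_3)).

Section Solution.
Context (c : R) (beta : R -> 'cV[R]_3).
Let A s := c *: Hmx (beta s).

Lemma generator_skew s i k : A s i k = - A s k i.
Proof. by rewrite mxE Hmx_skew mulrN -[in RHS]/(A s k i) [in RHS]mxE. Qed.

Lemma line_solution_entries X : line_solution c beta X ->
  forall i j (s : R), is_derive s (1 : R) (fun s => X s i j) ((A s *m X s) i j).
Proof. by move=> [dX _] i j s; rewrite -scalemxAl; exact: (is_derive_mxP _ _ _).1. Qed.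

Lemma line_solution_colsq X : line_solution c beta X -> forall s j, colsq (X s) j = 1.
Proof.
move=> hX s j; have cst := colsq_constant generator_skew (line_solution_entries hX) j.
have := @cvg_colsq _ (-oo : set_system R) _ X _ j hX.2; rewrite colsq1.
rewrite (_ : (fun t => colsq (X t) j) = fun=> colsq (X s) j); last exact/funext.
by move=> /(_ (@proper_ninfty_nbhs R)) h; exact: (cvg_cst_inv h).
Qed.

Lemma line_solution_entry_le1 X : line_solution c beta X -> forall s i j, `|X s i j| <= 1.
Proof.
move=> hX s i j; rewrite -(@expr_le1 _ 2)// real_normK ?num_real//.
by rewrite -(line_solution_colsq hX s j) le_colsq.
Qed.

(** The difference solves the same linear equation, so its columns have constant length, and this
    length tends to 0 at minus infinity. *)
Lemma line_solution_unique X Y : line_solution c beta X -> line_solution c beta Y -> X = Y.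
Proof.
move=> hX hY.
have dW i j (s : R) : is_derive s (1 : R) (fun s => (X s - Y s) i j) ((A s *m (X s - Y s)) i j).
  have d := is_deriveB (line_solution_entries hX i j s) (line_solution_entries hY i j s).
  rewrite (_ : (fun s => _) = (fun s => X s i j) - (fun s => Y s i j)).
    by apply: (is_derive_eq d); rewrite mulmxBr !mxE.
  by apply/funext => t; rewrite !mxE.
have lW : (X s - Y s) @[s --> -oo] --> (0 : 'M[R]_3).
  by rewrite -(subrr (1%:M : 'M[R]_3)); apply: cvgB; [exact: hX.2|exact: hY.2].
apply/funext => s; apply/eqP; rewrite -subr_eq0; apply/eqP/colsq_eq0 => j.
have cst := colsq_constant generator_skew dW j.
have := @cvg_colsq _ (-oo : set_system R) _ _ _ j lW; rewrite {2}/colsq big1; last by move=> i _; rewrite mxE mulr0.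
rewrite (_ : (fun t => colsq (X t - Y t) j) = fun=> colsq (X s - Y s) j); last exact/funext.
by move=> /(_ (@proper_ninfty_nbhs R)) h; exact: (cvg_cst_inv h).
Qed.

Context (a b : R) (ab : a <= b).
Hypothesis cb : forall i, continuous (fun s => beta s i 0).
Hypothesis b0 : forall i, vanishes_outside a b (fun s => beta s i 0).

Lemma generator_continuous i j : continuous (fun s => A s i j).
Proof.
have [r [k [_ rk]]] := Hmx_entry i j.
rewrite (_ : (fun s => A s i j) = fun s => c * r * beta s k 0).
  by apply: continuous_mul => // ?; exact: cvg_cst.
by apply/funext => s; rewrite mxE rk mulrA.
Qed.

Lemma generator_vanishes i j : vanishes_outside a b (fun s => A s i j).
Proof.
have [r [k [_ rk]]] := Hmx_entry i j.
by move=> s /b0/= sk; rewrite mxE rk sk !mulr0.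
Qed.

Lemma cvg_ninfty_eventually (X : R -> 'M[R]_3) l : (forall s, s <= a -> X s = l) ->
  X s @[s --> -oo] --> l.
Proof.
move=> Xl; apply: cvg_near_cst; near=> s; apply: Xl.
by near: s; apply: nbhs_ninfty_le; exact: num_real.
Unshelve. all: by end_near. Qed.

Lemma line_solution_exists : exists2 X, line_solution c beta X & forall s, s <= a -> X s = 1%:M.
Proof.
have [X [dX X1]] := linear_ode_exists generator_continuous generator_vanishes.
exists X => //; split; last exact: cvg_ninfty_eventually.
by move=> s; apply/is_derive_mxP => i j; rewrite scalemxAl; exact: dX.
Qed.

(** Only a limit is prescribed; uniqueness identifies [X] with the Picard solution, which already
    equals [I] up to [a]. *)
Lemma line_solution_left X : line_solution c beta X -> forall s, s <= a -> X s = 1%:M.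
Proof.
by move=> hX; have [Y hY Y1] := line_solution_exists; rewrite (line_solution_unique hX hY).
Qed.

Lemma line_solution_right X : line_solution c beta X -> forall s, b <= s -> X s = X b.
Proof.
move=> hX s bs; apply/matrixP => i j; apply/esym.
apply: (is_derive0_eq (line_solution_entries hX i j)) => // t /andP[bt _].
rewrite mxE big1// => k _; rewrite generator_vanishes ?mul0r//.
by rewrite negb_and -!leNgt bt orbT.
Qed.

Lemma line_solution_second_order X m : line_solution c beta X ->
  (forall s i, `|beta s i 0| <= m) -> forall i j,
  `|X b i j - (1%:M : 'M[R]_3) i j - \int[mu]_s A s i j| <= (3 * `|c| * m * (b - a)) ^+ 2.
Proof.
move=> hX bm i j.
have m0 : 0 <= m by apply: le_trans (bm 0 0).
(* A bound for the entries of [A *m X]: three products of an entry of [A], at most [|c| * m], with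
   an entry of [X], at most 1. *)
pose k := 3 * (`|c| * m); have k0 : 0 <= k by rewrite !mulr_ge0.
have Am s i' j' : `|A s i' j'| <= `|c| * m.
  have [r [l [r1 rk]]] := Hmx_entry i' j'.
  rewrite mxE rk normrM ler_wpM2l// normrM -[leRHS]mul1r ler_pM//.
have Xa : X a = 1%:M by exact: line_solution_left.
have dlin q (s : R) : is_derive s (1 : R) (fun s => q * (s - a)) q.
  by apply: is_derive_eq; rewrite subr0 scaler1.
have first i' j' s : a <= s <= b -> `|X s i' j' - (1%:M : 'M[R]_3) i' j'| <= k * (s - a).
  have dD (t : R) : is_derive t (1 : R) (fun t => X t i' j' - (1%:M : 'M[R]_3) i' j') ((A t *m X t) i' j').
    have d := is_deriveB (line_solution_entries hX i' j' t) (is_derive_cst ((1%:M : 'M[R]_3) i' j') t (1 : R)).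
    by apply: (is_derive_eq d); rewrite subr0.
  apply: (is_derive_norm_le dD (dlin k)).
    move=> t _; rewrite (le_trans (mulmx_entry_le (Am t i') _ (w := 1)))//.
      by move=> l; exact: line_solution_entry_le1.
    by rewrite mulr1.
  by rewrite Xa !subrr normr0 mulr0.
(* Subtracting the integral of [A] leaves the derivative [A *m (X - I)], of size at most
   [k * (k * (b - a))]; integration gives the square. *)
have dE (t : R) : is_derive t (1 : R)
    (fun t => X t i j - (1%:M : 'M[R]_3) i j - primitive (fun s => A s i j) t)
    ((A t *m (X t - 1%:M)) i j).
  have d := is_deriveB (line_solution_entries hX i j t) (is_derive_cst ((1%:M : 'M[R]_3) i j) t (1 : R)).
  have d' := is_deriveB d (is_derive_primitive (@generator_continuous i j) (@generator_vanishes i j) t).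
  by apply: (is_derive_eq d'); rewrite subr0 mulmxBr mulmx1 !mxE.
rewrite -(primitive_right (@generator_vanishes i j) (lexx b)).
have -> : (3 * `|c| * m * (b - a)) ^+ 2 = k * (k * (b - a)) * (b - a) by rewrite /k; ring.
apply: (is_derive_norm_le dE (dlin (k * (k * (b - a)))) (a := a) (b := b)).
- move=> t /andP[ta tb].
  apply: (le_trans (mulmx_entry_le (Am t i) _ (w := k * (b - a)))) => // l.
  rewrite mxE [X in _ + X]mxE (le_trans (first _ _ _ _)) ?ta//.
  by rewrite ler_wpM2l// lerB.
- by rewrite Xa (primitive_left (@generator_vanishes i j) (lexx a)) !subrr normr0 mulr0.
- by rewrite ab lexx.
Qed.

End Solution.
End LineODE.

(** * Scalar products, and test functions restricted to the lines of the plane *)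

Section Geometry.
Context {R : realType}.
Implicit Types (u w x y eta xi : 'cV[R]_3) (f : 'cV[R]_3 -> R).
Local Notation mu := (@lebesgue_measure R).

Lemma dotE u w : dot u w = \sum_i u i 0 * w i 0.
Proof. by rewrite /dot mxE; apply: eq_bigr => i _; rewrite mxE. Qed.

Lemma dotDl u u' w : dot (u + u') w = dot u w + dot u' w.
Proof. by rewrite !dotE -big_split; apply: eq_bigr => i _; rewrite mxE mulrDl. Qed.

Lemma dotZl (s : R) u w : dot (s *: u) w = s * dot u w.
Proof. by rewrite !dotE mulr_sumr; apply: eq_bigr => i _; rewrite mxE mulrA. Qed.

Lemma dotC u w : dot u w = dot w u.
Proof. by rewrite !dotE; apply: eq_bigr => i _; rewrite mulrC. Qed.

Lemma dotDr u w w' : dot u (w + w') = dot u w + dot u w'.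
Proof. by rewrite dotC dotDl !(dotC u). Qed.

Lemma dotZr (s : R) u w : dot u (s *: w) = s * dot u w.
Proof. by rewrite dotC dotZl (dotC u). Qed.

Lemma dot_ge0 u : 0 <= dot u u.
Proof. by rewrite dotE sumr_ge0// => i _; rewrite -expr2 sqr_ge0. Qed.

Lemma enorm_sqr u : enorm u ^+ 2 = dot u u.
Proof. by rewrite sqr_sqrtr// dot_ge0. Qed.

Lemma norm_entry_le_enorm u i : `|u i 0| <= enorm u.
Proof.
rewrite -sqrtr_sqr /enorm ler_wsqrtr// dotE (bigD1 i)//= -expr2 lerDl sumr_ge0// => k _.
by rewrite -expr2 sqr_ge0.
Qed.

Lemma norm_dot_le u w (r q : R) : (forall i, `|u i 0| <= r) -> (forall i, `|w i 0| <= q) ->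
  `|dot u w| <= 3 * r * q.
Proof.
move=> ur wq; rewrite dotE (le_trans (ler_norm_sum _ _ _))//.
rewrite (@le_trans _ _ (\sum_(k < 3) r * q))//.
  by apply: ler_sum => k _; rewrite normrM ler_pM.
by rewrite sumr_const card_ord -[leLHS]mulr_natl mulrA.
Qed.

Lemma norm_entry_le (x : 'cV[R]_3) i : `|x i 0| <= `|x|.
Proof.
rewrite [leRHS]/Num.Def.normr/= mx_normrE; exact: (le_bigmax _ _ (i, 0)).
Qed.

Lemma plane_shift eta z x u (s : R) : plane eta z x -> dot u eta = 0 -> plane eta z (x + s *: u).
Proof. by rewrite /plane/= dotDl dotZl => -> ->; rewrite mulr0 addr0. Qed.

Lemma compact_entries_bounded (K : set 'cV[R]_3) : compact K ->
  exists2 r, 0 <= r & forall x, K x -> forall i, `|x i 0| <= r.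
Proof.
move=> /compact_bounded[M [_ hM]]; exists (`|M| + 1); first by rewrite addr_ge0.
move=> x Kx i; apply: (le_trans (norm_entry_le x i)).
by apply: (hM (`|M| + 1)) Kx; rewrite (le_lt_trans (ler_norm M))// ltrDl.
Qed.

Lemma continuous_dotl eta : continuous (fun x => dot x eta).
Proof.
rewrite (_ : (fun x => _) = fun x => \sum_i x i 0 * eta i 0); last first.
  by apply/funext => x; rewrite dotE.
move=> x; apply: (@cvg_big _ _ _ _ _ _ _ (nbhs x)) => [|i _]; first exact: add_continuous.
by apply: cvgM; [exact: coord_continuous|exact: cvg_cst].
Qed.

Lemma closed_plane eta z : closed (plane eta z).
Proof.
have -> : plane eta z = (fun x => dot x eta) @^-1` [set z] by [].
apply: closed_comp => [x _|]; [exact: continuous_dotl|exact: closed_eq].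
Qed.

(** Stated along lines of the plane, since nothing is known of [f] off it; this form passes easily
    to multiples and differences. *)
Definition line_continuous eta z f := forall x u, plane eta z x -> dot u eta = 0 ->
  continuous (fun s : R => f (x + s *: u)).

Definition supported_within eta z (r : R) f :=
  forall x, plane eta z x -> f x != 0 -> forall i, `|x i 0| <= r.

Definition bounded_on_plane eta z (C : R) f := forall x, plane eta z x -> `|f x| <= C.

Lemma within_line_continuous eta z f : {within plane eta z, continuous f} ->
  line_continuous eta z f.
Proof.
move=> /subspace_continuousP cf x u px ue s P nP.
have := cf _ (plane_shift s px ue) P nP; rewrite /= /within/= => nQ.
have cl : continuous (fun t : R => x + t *: u).
  move=> t; apply: cvgD; first exact: cvg_cst.
  by apply: cvgZ; [exact: cvg_id|exact: cvg_cst].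
have h : \forall t \near s, plane eta z (x + t *: u) -> P (f (x + t *: u)) := cl s _ nQ.
change (\forall t \near s, P (f (x + t *: u))).
by near=> t; have := near h t; apply => //; exact: plane_shift.
Unshelve. all: by end_near.
Qed.

Lemma test_function_line_continuous eta z f : test_function eta z f -> line_continuous eta z f.
Proof.
move=> [sf _]; apply: within_line_continuous.
by have [] := sf [::] (fun u => ltac:(by [])).
Qed.

Lemma test_function_supported eta z f : test_function eta z f ->
  exists2 r, 0 <= r & supported_within eta z r f.
Proof.
move=> [_ /compact_entries_bounded[r r0 hr]]; exists r => // x px fx.
by apply: hr; apply: subset_closure.
Qed.

(** The plane being closed, the compact support lies in it, so continuity within the plane gives a
    compact, hence bounded, image. *)
Lemma test_function_bounded eta z f : test_function eta z f ->
  exists2 C, 0 <= C & bounded_on_plane eta z C f.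
Proof.
move=> [sf]; rewrite /compact_support_on_plane => cK; have [cf _] := sf [::] (fun u => ltac:(by [])).
pose K := closure [set x | plane eta z x /\ f x != 0].
have Kp : K `<=` plane eta z.
  rewrite [X in _ `<=` X](closure_id _).1; last exact: closed_plane.
  by apply: closure_subset => x [].
have /compact_bounded[M [_ hM]] := continuous_compact (continuous_subspaceW Kp cf) cK.
exists (`|M| + 1); first by rewrite addr_ge0.
move=> x px; have [->|fx] := eqVneq (f x) 0; first by rewrite normr0 addr_ge0.
apply: (hM (`|M| + 1)); first by rewrite (le_lt_trans (ler_norm M))// ltrDl.
by exists x => //; apply: subset_closure.
Qed.

(** As [xi] is a unit vector, [s + dot xi x] is the scalar product of [xi] with the point
    [x + s *: xi], hence at most [3 * r] in absolute value on the support; the 1 makes the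
    inequalities strict. The centre of the interval is the parameter of the point nearest to the
    origin, so the length is the same for all lines. *)
Lemma line_vanishes eta z r f x xi : supported_within eta z r f ->
  plane eta z x -> direction eta xi ->
  vanishes_outside (- dot xi x - (3 * r + 1)) (- dot xi x + (3 * r + 1)) (fun s => f (x + s *: xi)).
Proof.
move=> fr px [xi1 xie] s; apply: contraNeq => fs.
have yr := fr _ (plane_shift s px xie) fs.
have xi1' i : `|xi i 0| <= 1 by rewrite -xi1 norm_entry_le_enorm.
have := norm_dot_le xi1' yr.
rewrite dotDr dotZr -enorm_sqr xi1 expr1n !mulr1 ler_norml => /andP[]; lra.
Qed.

End Geometry.

(** * Second-order expansion and derivative of the forward map *)

Section Forward.
Context {R : realType} (gammaN v : R) (eta : 'cV[R]_3) (z : R).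
Local Notation mu := (@lebesgue_measure R).
Let c := gammaN / v.

Section Field.
Context (B : 'cV[R]_3 -> 'cV[R]_3) (r : R) (r0 : 0 <= r).
Hypothesis lB : forall i, line_continuous eta z (component B i).
Hypothesis sB : forall i, supported_within eta z r (component B i).

Let left_end x xi : R := - dot xi x - (3 * r + 1).
Let right_end x xi : R := - dot xi x + (3 * r + 1).

Lemma line_field_continuous x xi : plane eta z x -> direction eta xi ->
  forall i, continuous (fun s : R => B (x + s *: xi) i 0).
Proof. by move=> px [_ xe] i; exact: (lB px xe). Qed.

Lemma line_field_vanishes x xi : plane eta z x -> direction eta xi ->
  forall i, vanishes_outside (left_end x xi) (right_end x xi) (fun s : R => B (x + s *: xi) i 0).
Proof. by move=> px dxi i; exact: (line_vanishes (@sB i) px dxi). Qed.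

(* Solutions along a line based at different points of it agree up to translation, by uniqueness;
   hence their values at the base points define a function of position and direction. *)
Lemma is_Sigma_exists : exists Sigma, is_Sigma gammaN v eta z B Sigma.
Proof.
have /choice[X hX] : forall p : 'cV[R]_3 * 'cV[R]_3, exists X,
    plane eta z p.1 -> direction eta p.2 ->
    line_solution c (fun s => B (p.1 + s *: p.2)) X /\
    forall s, s <= left_end p.1 p.2 -> X s = 1%:M.
  move=> [x xi] /=; have [[px dxi]|np] := pselect (plane eta z x /\ direction eta xi).
    have [X hX X1] := line_solution_exists c (line_field_continuous px dxi) (line_field_vanishes px dxi).
    by exists X.
  by exists (fun=> 0) => px dxi; exfalso; apply: np.
exists (fun x xi => X (x, xi) 0) => x xi px dxi.
have [[dX lX] X1] := hX (x, xi) px dxi.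
suff E s : X (x + s *: xi, xi) 0 = X (x, xi) s.
  have -> : (fun s => X (x + s *: xi, xi) 0) = X (x, xi) by exact/funext.
  by split => // s; rewrite E.
have ps := plane_shift s px dxi.2.
have [hY _] := hX (x + s *: xi, xi) ps dxi.
suff hZ : line_solution c (fun t => B (x + s *: xi + t *: xi)) (fun t => X (x, xi) (s + t)).
  by rewrite (line_solution_unique hY hZ) addr0.
split.
  move=> t; apply/is_derive_mxP => i j.
  have d1 : is_derive t (1 : R) (fun t => s + t) 1.
    have d := is_deriveD (is_derive_cst s t (1 : R)) (is_derive_id t (1 : R)).
    by apply: (is_derive_eq d); rewrite add0r.
  have d2 := (is_derive_mxP _ _ _).1 (dX (s + t)) i j.
  have d3 : is_derive t (1 : R) ((fun u => X (x, xi) u i j) \o (fun t => s + t))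
      ((c *: (Hmx (B (x + (s + t) *: xi)) *m X (x, xi) (s + t))) i j * 1).
    exact: is_derive1_comp.
  by apply: (is_derive_eq d3); rewrite mulr1 scalerDl addrA.
apply: (@cvg_ninfty_eventually _ (left_end x xi - s)) => t ts.
by apply: X1; rewrite /= -lerBrDl.
Qed.

Lemma Sigma_of_line_solution x xi : plane eta z x -> direction eta xi ->
  line_solution c (fun s => B (x + s *: xi)) (fun s => Sigma_of gammaN v eta z B (x + s *: xi) xi).
Proof.
move=> px dxi; have [Sigma hS] := is_Sigma_exists.
have h : is_Sigma gammaN v eta z B (Sigma_of gammaN v eta z B).
  apply: (@xgetPex _ _ [set Sigma | is_Sigma gammaN v eta z B Sigma]).
  by exists Sigma.
exact: h.
Qed.

(** Beyond the support the solution is constant, so the limit at plus infinity is attained. *)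
Lemma forwardE x xi : plane eta z x -> direction eta xi ->
  forward gammaN v eta z B x xi = Sigma_of gammaN v eta z B (x + right_end x xi *: xi) xi.
Proof.
move=> px dxi; have hX := Sigma_of_line_solution px dxi.
apply: cvg_lim; first exact: norm_hausdorff.
apply: cvg_near_cst; near=> s.
apply: (line_solution_right (line_field_vanishes px dxi) hX).
by near: s; apply: nbhs_pinfty_ge; exact: num_real.
Unshelve. all: by end_near. Qed.

Lemma forward_second_order (m : R) x xi : plane eta z x -> direction eta xi ->
  (forall y i, plane eta z y -> `|B y i 0| <= m) -> forall i j,
  `|forward gammaN v eta z B x xi i j - (1%:M : 'M[R]_3) i j
    - \int[mu]_s (c *: Hmx (B (x + s *: xi))) i j| <= (3 * `|c| * m * (6 * r + 2)) ^+ 2.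
Proof.
move=> px dxi Bm i j; rewrite forwardE//.
have ab : left_end x xi <= right_end x xi.
  have r1 : (0 : R) <= 3 * r + 1 by rewrite addr_ge0// mulr_ge0.
  by rewrite /left_end /right_end; lra.
have := line_solution_second_order ab (line_field_continuous px dxi)
  (line_field_vanishes px dxi) (Sigma_of_line_solution px dxi) (m := m) _ i j.
rewrite (_ : right_end x xi - left_end x xi = 6 * r + 2); last first.
  by rewrite /left_end /right_end; ring.
by apply => s k; apply: Bm; exact: plane_shift px dxi.2.
Qed.

Lemma Rintegral_generator_cyclic x xi (i : 'I_3) : plane eta z x -> direction eta xi ->
  \int[mu]_s (c *: Hmx (B (x + s *: xi))) i (i + 1) = c * Xray (component B (i + 2%:R)) x xi.
Proof.
move=> px dxi; rewrite /Xray -RintegralZl//.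
  by apply: eq_Rintegral => s _; rewrite mxE Hmx_cyclic.
apply: (@vanishes_integrable _ (left_end x xi) (right_end x xi)).
  exact: line_field_continuous.
exact: line_field_vanishes.
Qed.

End Field.

Lemma matrix_coefE (A : 'M[R]_3) i j : matrix_coef A i j = A i j.
Proof. by rewrite /matrix_coef /dot /stdbasis -colE trmx_delta -rowE !mxE. Qed.

Lemma ord3_succ_neq (i : 'I_3) : (i == i + 1) = false.
Proof. by case: i => [[|[|[|//]]] ?]. Qed.

(** The entries [(i, i + 1)] lie off the diagonal, so the identity matrix drops out of the
    expansion. *)
Lemma matrix_coef_forward_second_order (B : 'cV[R]_3 -> 'cV[R]_3) (r m : R) x xi : 0 <= r ->
  (forall i, line_continuous eta z (component B i)) ->
  (forall i, supported_within eta z r (component B i)) ->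
  plane eta z x -> direction eta xi ->
  (forall y i, plane eta z y -> `|B y i 0| <= m) -> forall i : 'I_3,
  `|matrix_coef (forward gammaN v eta z B x xi) i (i + 1)
    - c * Xray (component B (i + 2%:R)) x xi| <= (3 * `|c| * (6 * r + 2)) ^+ 2 * m ^+ 2.
Proof.
move=> r0 lB sB px dxi Bm i.
have := forward_second_order r0 lB sB px dxi Bm i (i + 1).
rewrite (Rintegral_generator_cyclic lB sB)// matrix_coefE mxE ord3_succ_neq subr0.
by move=> h; rewrite -exprMn (mulrAC _ _ m).
Qed.

Lemma test_field_regular B : test_field eta z B -> exists r m, [/\ 0 <= r,
  forall i, line_continuous eta z (component B i),
  forall i, supported_within eta z r (component B i) &
  forall y i, plane eta z y -> `|B y i 0| <= m].
Proof.
move=> tB.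
have /choice[r hr] : forall i, exists r, 0 <= r /\ supported_within eta z r (component B i).
  by move=> i; have [r ? ?] := test_function_supported (tB i); exists r.
have /choice[m hm] : forall i, exists m, 0 <= m /\ bounded_on_plane eta z m (component B i).
  by move=> i; have [m ? ?] := test_function_bounded (tB i); exists m.
have le_sum (f : 'I_3 -> R) i : (forall i, 0 <= f i) -> f i <= \sum_k f k.
  by move=> f0; rewrite (bigD1 i)//= lerDl sumr_ge0.
exists (\sum_i r i), (\sum_i m i); split.
- by apply: sumr_ge0 => i _; have [] := hr i.
- by move=> i; exact: test_function_line_continuous.
- move=> i x px fx k; have [_ h] := hr i; apply: (le_trans (h x px fx k)).
  by apply: le_sum => l; have [] := hr l.
- move=> y i py; have [_ h] := hm i; apply: (le_trans (h y py)).
  by apply: le_sum => l; have [] := hm l.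
Qed.

(** A supremum is an upper bound only for a bounded set, hence the recourse to the bounds of
    [test_field_regular]. *)
Lemma norm_entry_le_field_norm B : test_field eta z B ->
  forall y i, plane eta z y -> `|B y i 0| <= field_norm eta z B.
Proof.
move=> tB y i py; apply: (le_trans (norm_entry_le_enorm _ i)).
have [_ [m [_ _ _ hm]]] := test_field_regular tB.
apply: ub_le_sup; last by exists y.
exists (Num.sqrt (3 * m * m)) => _ [x px <-].
rewrite ler_wsqrtr// (le_trans (ler_norm _))// norm_dot_le// => k; exact: hm.
Qed.

(** The error bound involves the extent of the support; here [r] comes from [K] alone, so [C] is
    common to all fields supported in [K]. *)
Lemma forward_expansion (K : set 'cV[R]_3) : compact K ->
  exists C delta : R, 0 < delta /\
    forall B : 'cV[R]_3 -> 'cV[R]_3, test_field eta z B ->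
      (forall x, plane eta z x -> ~ K x -> B x = 0) ->
      field_norm eta z B <= delta ->
      forall x xi : 'cV[R]_3, plane eta z x -> direction eta xi ->
      forall i : 'I_3,
        `| matrix_coef (forward gammaN v eta z B x xi) i (i + 1)
           - gammaN / v * Xray (component B (i + 2%:R)) x xi |
        <= C * field_norm eta z B ^+ 2.
Proof.
move=> /compact_entries_bounded[r r0 hr].
exists ((3 * `|c| * (6 * r + 2)) ^+ 2), 1; split => // B tB BK _ x xi px dxi i.
apply: matrix_coef_forward_second_order => //.
- by move=> k; exact: test_function_line_continuous.
- move=> k y py yB; apply: hr; apply: contrapT => nK; move: yB.
  by rewrite /component BK// mxE eqxx.
- exact: norm_entry_le_field_norm.
Qed.

(** The bound at [t = 0] forces [g 0 = g0]; divided by [t], it puts the difference quotient within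
    [C * |t|] of [l]. *)
Lemma quadratic_is_derive (g : R -> R) g0 l C :
  (forall t, `|g t - g0 - t * l| <= C * t ^+ 2) -> is_derive (0 : R) (1 : R) g l.
Proof.
move=> gC.
have g00 : g 0 = g0.
  by have := gC 0; rewrite expr0n mulr0 mul0r subr0 normr_le0 subr_eq0 => /eqP.
have C0 : 0 <= C by have := gC 1; rewrite expr1n mulr1; exact: le_trans.
have H : h^-1 *: (g (h *: (1 : R) + 0) - g 0) @[h --> (0 : R)^'] --> l.
  apply/cvgrPdist_le => e e0; near=> h.
  have hn0 : h != 0 by near: h; exact: nbhs_dnbhs_neq.
  (* [C + 1] because [C] may be 0. *)
  have hC : `|h| <= e / (C + 1).
    by near: h; apply: dnbhs0_le; rewrite divr_gt0// ltr_wpDl.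
  rewrite addr0 g00 distrC /GRing.scale/= mulr1.
  have -> : h^-1 * (g h - g0) - l = h^-1 * (g h - g0 - h * l).
    by rewrite [RHS]mulrBr mulKf.
  rewrite normrM normfV ler_pdivrMl ?normr_gt0// (le_trans (gC h))//.
  rewrite -real_normK ?num_real// expr2 mulrA mulrC ler_wpM2l//.
  move: hC; rewrite ler_pdivlMr ?ltr_wpDl// mulrC => hC; apply: le_trans hC.
  by rewrite ler_wpM2r// lerDl.
apply: DeriveDef; first by apply/cvg_ex; exists l.
exact: (cvg_lim (@norm_hausdorff _ _) H).
Unshelve. all: by end_near. Qed.

(** Scaling by [t] keeps the radius [r] and turns the bound [m] into [|t| * m], so the error is
    quadratic in [t]. All nine entries are treated, because [linearized_forward] is the derivative
    of the whole matrix. *)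
Lemma forward_is_derive B x xi : test_field eta z B -> plane eta z x -> direction eta xi ->
  is_derive (0 : R) (1 : R) (fun t : R => forward gammaN v eta z (scale_field t B) x xi)
    (\matrix_(i, j) \int[mu]_s (c *: Hmx (B (x + s *: xi))) i j).
Proof.
move=> tB px dxi; have [r [m [r0 lB sB Bm]]] := test_field_regular tB.
apply/is_derive_mxP => i j.
apply: (@quadratic_is_derive _ ((1%:M : 'M[R]_3) i j) _ ((3 * `|c| * m * (6 * r + 2)) ^+ 2)) => t.
have lB' k : line_continuous eta z (component (scale_field t B) k).
  move=> y u py ue; rewrite (_ : (fun s => _) = fun s : R => t * component B k (y + s *: u)).
    by apply: continuous_mul; [move=> ?; exact: cvg_cst|exact: lB].
  by apply/funext => s; rewrite /component mxE.
have sB' k : supported_within eta z r (component (scale_field t B) k).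
  move=> y py yB; apply: (sB k) => //; apply: contra yB => /eqP yB.
  by rewrite /component mxE -/(component B k y) yB mulr0.
have Bm' y k : plane eta z y -> `|scale_field t B y k 0| <= `|t| * m.
  by move=> py; rewrite mxE normrM ler_wpM2l// Bm.
have := forward_second_order r0 lB' sB' px dxi Bm' i j.
rewrite [X in t * X]mxE -RintegralZl//; last first.
  have cb := line_field_continuous lB px dxi.
  have b0 := line_field_vanishes sB px dxi.
  exact: (vanishes_integrable (@generator_continuous _ c _ cb i j) (@generator_vanishes _ c _ _ _ b0 i j)).
rewrite (@eq_Rintegral _ _ _ mu _ (fun s => t * (c *: Hmx (B (x + s *: xi))) i j)).
  move=> h; apply: (le_trans h).
  have -> : t ^+ 2 = `|t| ^+ 2 by rewrite real_normK ?num_real.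
  rewrite -exprMn le_eqVlt; apply/orP; left.
  by apply/eqP; congr (_ ^+ 2); ring.
by move=> s _; rewrite /scale_field HmxZ !mxE; ring.
Qed.

Lemma forward_linearization B x xi : test_field eta z B -> plane eta z x -> direction eta xi ->
  derivable (fun t : R => forward gammaN v eta z (scale_field t B) x xi) 0 1 /\
  forall i : 'I_3, matrix_coef (linearized_forward gammaN v eta z B x xi) i (i + 1)
    = gammaN / v * Xray (component B (i + 2%:R)) x xi.
Proof.
move=> tB px dxi; have [dF eF] := forward_is_derive tB px dxi.
have [r [m [r0 lB sB Bm]]] := test_field_regular tB.
split=> // i; rewrite matrix_coefE /linearized_forward derive1E eF mxE.
exact: (Rintegral_generator_cyclic lB sB).
Qed.

End Forward.

(** * Injectivity of the X-ray transform on the plane, and existence of an inversion method *)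

Section Injectivity.
Context {R : realType}.
Implicit Types (u w x y eta xi : 'cV[R]_3) (f : 'cV[R]_3 -> R).
Local Notation mu := (@lebesgue_measure R).

Lemma dot3E u w : dot u w = u 0 0 * w 0 0 + u 1 0 * w 1 0 + u 2%:R 0 * w 2%:R 0.
Proof.
rewrite dotE !big_ord_recl big_ord0 addr0 addrA.
by congr (_ + u _ _ * w _ _ + u _ _ * w _ _); exact: val_inj.
Qed.

Definition vec3 (a b c : R) : 'cV[R]_3 := \col_(i < 3) nth 0 [:: a; b; c] i.

Lemma dot_vec3 (a b c : R) w : dot (vec3 a b c) w = a * w 0 0 + b * w 1 0 + c * w 2%:R 0.
Proof. by rewrite dot3E !mxE. Qed.

(** Away from the third axis, [e] is horizontal and [k] is the cross product of [eta] and [e]; on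
    the axis the first two basis vectors serve. The vectors are not normalized, which avoids square
    roots. *)
Lemma orthogonal_frame eta : dot eta eta = 1 -> exists e k,
  [/\ dot e eta = 0, dot k eta = 0, dot e k = 0, 0 < dot e e & 0 < dot k k].
Proof.
rewrite dot3E; set p := eta 0 0; set q := eta 1 0; set r := eta 2%:R 0 => pqr.
have [pq0|pq0] := eqVneq (p * p + q * q) 0.
  have p0 : p = 0 by nra.
  have q0 : q = 0 by nra.
  exists (vec3 1 0 0), (vec3 0 1 0).
  rewrite !dot_vec3 !mxE/= -/p -/q -/r p0 q0.
  by split; rewrite ?mulr0 ?mul0r ?mulr1 ?addr0 ?add0r// ltr01.
have pq : 0 < p * p + q * q by rewrite lt_neqAle eq_sym pq0 addr_ge0// -expr2 sqr_ge0.
exists (vec3 (- q) p 0), (vec3 (- r * p) (- r * q) (p * p + q * q)).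
rewrite !dot_vec3 !mxE/= -/p -/q -/r; split; [ring|ring|ring|lra|].
have -> : - r * p * (- r * p) + - r * q * (- r * q) + (p * p + q * q) * (p * p + q * q)
    = (p * p + q * q) * (p * p + q * q + r * r) by ring.
by rewrite pqr mulr1.
Qed.

Lemma direction_normalize eta u : dot u eta = 0 -> 0 < dot u u ->
  0 < enorm u /\ direction eta ((enorm u)^-1 *: u).
Proof.
move=> ue u0; have n0 : 0 < enorm u by rewrite sqrtr_gt0.
split=> //; split; last by rewrite dotZl ue mulr0.
rewrite {1}/enorm dotZl dotZr -enorm_sqr expr2 mulKf ?gt_eqF//.
by rewrite mulVf ?gt_eqF// sqrtr1.
Qed.

Lemma Xray_injective eta z f1 f2 : dot eta eta = 1 ->
  test_function eta z f1 -> test_function eta z f2 ->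
  (forall x xi, plane eta z x -> direction eta xi -> Xray f1 x xi = Xray f2 x xi) ->
  forall y, plane eta z y -> f1 y = f2 y.
Proof.
move=> eta1 t1 t2 X12 y py.
have [r1 r10 s1] := test_function_supported t1; have [r2 r20 s2] := test_function_supported t2.
have [C1 C10 b1] := test_function_bounded t1; have [C2 C20 b2] := test_function_bounded t2.
have l1 := test_function_line_continuous t1; have l2 := test_function_line_continuous t2.
pose g x := f1 x - f2 x; pose r := r1 + r2.
have sg : supported_within eta z r g.
  move=> x px gx i; have [f10|f10] := eqVneq (f1 x) 0.
    have f20 : f2 x != 0 by apply: contra gx => /eqP; rewrite /g f10 => ->; rewrite subrr.
    by rewrite (le_trans (s2 x px f20 i))// lerDr.
  by rewrite (le_trans (s1 x px f10 i))// lerDl.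
have lg : line_continuous eta z g.
  by move=> x u px ue s; apply: cvgB; [exact: l1|exact: l2].
have bg : bounded_on_plane eta z (C1 + C2) g.
  by move=> x px; rewrite (le_trans (ler_normB _ _))// lerD ?b1 ?b2.
have Xg x xi : plane eta z x -> direction eta xi -> Xray g x xi = 0.
  move=> px dxi; rewrite /Xray RintegralB//.
  - by move: (X12 x xi px dxi); rewrite /Xray => ->; rewrite subrr.
  - exact: vanishes_integrable (l1 x xi px dxi.2) (line_vanishes s1 px dxi).
  - exact: vanishes_integrable (l2 x xi px dxi.2) (line_vanishes s2 px dxi).
have [e [k [ee ke ek e0 k0]]] := orthogonal_frame eta1.
have perp (a b : R) : dot (a *: e + b *: k) eta = 0.
  by rewrite dotDl !dotZl ee ke !mulr0 addr0.
(* The chart is centred at the point [y] under study, so the claim becomes [g (p 0 0) = 0]. *)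
pose p (a b : R) := y + (a *: e + b *: k).
have pp a b : plane eta z (p a b).
  by have := plane_shift 1 py (perp a b); rewrite scale1r.
(* The product with a frame vector [w] isolates one coordinate up to the factor [d = dot w w]; on
   the support it is at most [3 * enorm w * r], which bounds that coordinate. *)
have extent w (d : R) (co : R -> R -> R) : 0 < d ->
    (forall a b, dot w (p a b) = dot w y + co a b * d) ->
    exists2 M : R, 0 <= M & forall a b, g (p a b) != 0 -> - M < co a b < M.
  move=> d0 wE; pose Q := 3 * enorm w * r + `|dot w y|.
  have Q0 : 0 <= Q by rewrite addr_ge0// mulr_ge0// ?addr_ge0// mulr_ge0// sqrtr_ge0.
  exists (Q / d + 1); first by rewrite addr_ge0// divr_ge0// ltW.
  move=> a b gp; have := norm_dot_le (norm_entry_le_enorm w) (sg _ (pp a b) gp).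
  rewrite wE => h.
  have : `|co a b * d| <= Q.
    rewrite (_ : co a b * d = dot w y + co a b * d - dot w y); last by rewrite addrC addKr.
    by rewrite (le_trans (ler_normB _ _))// lerD2r.
  rewrite normrM (gtr0_norm d0) -ler_pdivlMr// ler_norml => /andP[]; lra.
have [|Me Me0 he] := extent e (dot e e) (fun a _ => a) e0.
  by move=> a b; rewrite /p !dotDr !dotZr ek mulr0 addr0.
have [|Mk Mk0 hk] := extent k (dot k k) (fun _ b => b) k0.
  by move=> a b; rewrite /p !dotDr !dotZr (dotC k e) ek mulr0 add0r.
pose M := Me + Mk.
suff : g (p 0 0) = 0.
  by rewrite /p !scale0r !addr0 => /eqP; rewrite subr_eq0 => /eqP.
apply: (@planar_lines_injective _ (fun a b => g (p a b)) M (C1 + C2)).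
- move=> a b u w.
  rewrite (_ : (fun s => _) = fun s : R => g (p a b + s *: (u *: e + w *: k))); first exact: lg.
  by apply/funext => s; rewrite /p; congr g; apply/matrixP => i j; rewrite !mxE; ring.
- by move=> a b; exact: bg.
- by move=> a b; apply: contraNeq => /he/andP[]; rewrite /M; lra.
- by move=> a b; apply: contraNeq => /hk/andP[]; rewrite /M; lra.
move=> s t.
pose u := 1 *: e + s *: k.
have u0 : 0 < dot u u.
  rewrite /u !dotDl !dotDr !dotZl !dotZr (dotC k e) ek; nra.
have [n0 du] := direction_normalize (perp 1 s) u0.
(* The line [b = s * a + t] is run through with velocity [u], which need not be a unit vector;
   rescaling the parameter by [enorm u] leads to the unit direction that [Xray] expects. *)
have e1 a : g (p a (s * a + t)) = g (p 0 t + (enorm u * a + 0) *: ((enorm u)^-1 *: u)).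
  rewrite addr0 scalerA mulrAC mulfV ?gt_eqF// mul1r /p /u; congr g.
  by apply/matrixP => i j; rewrite !mxE; ring.
under eq_Rintegral do rewrite e1.
rewrite (@Rintegral_affine _ _ _ (fun s => g (p 0 t + s *: ((enorm u)^-1 *: u))) _ 0 n0 _ (line_vanishes sg (pp 0 t) du)); last first.
  exact: (lg _ _ (pp 0 t) du.2).
by move: (Xg _ _ (pp 0 t) du); rewrite /Xray => ->; rewrite mulr0.
Qed.

(** Choose any test function with the given line integrals; by injectivity its values on the plane
    do not depend on the choice. *)
Lemma Radon_inversion_exists eta z : dot eta eta = 1 ->
  exists Inv, Radon_inversion eta z Inv.
Proof.
move=> eta1.
pose data (g : 'cV[R]_3 -> 'cV[R]_3 -> R) := [set f | test_function eta z f /\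
  forall x xi, plane eta z x -> direction eta xi -> g x xi = Xray f x xi].
exists (fun g => xget (fun=> 0) (data g)) => f g tf gf y py.
have [tf' gf'] : data g (xget (fun=> 0) (data g)) by apply: xgetPex; exists f.
apply: (Xray_injective eta1 tf' tf) => // x xi px dxi.
by rewrite -gf// gf'.
Qed.

End Injectivity.

Theorem mainTheorem4 (R : realType) (gammaN v : R) (hgamma : gammaN != 0)
    (hv : 0 < v) (eta : 'cV[R]_3) (heta : enorm eta = 1) (z : R) :
  (* second-order expansion, uniform over fields supported in a fixed compact *)
  (forall K : set 'cV[R]_3, compact K ->
     exists C delta : R, 0 < delta /\
       forall B : 'cV[R]_3 -> 'cV[R]_3, test_field eta z B ->
         (forall x, plane eta z x -> ~ K x -> B x = 0) ->
         field_norm eta z B <= delta ->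
         forall x xi : 'cV[R]_3, plane eta z x -> direction eta xi ->
         forall i : 'I_3,
           `| matrix_coef (forward gammaN v eta z B x xi) i (i + 1)
              - gammaN / v * Xray (component B (i + 2%:R)) x xi |
           <= C * field_norm eta z B ^+ 2) /\
  (* linearization of the forward map about the zero field *)
  (forall B : 'cV[R]_3 -> 'cV[R]_3, test_field eta z B ->
     forall x xi : 'cV[R]_3, plane eta z x -> direction eta xi ->
       derivable (fun t : R => forward gammaN v eta z (scale_field t B) x xi)
         0 1 /\
       forall i : 'I_3,
         matrix_coef (linearized_forward gammaN v eta z B x xi) i (i + 1)
         = gammaN / v * Xray (component B (i + 2%:R)) x xi) /\
  (* retrieval of the field from the linearized data *)
  (exists Inv, Radon_inversion eta z Inv) /\
  (forall Inv, Radon_inversion eta z Inv ->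
     forall B : 'cV[R]_3 -> 'cV[R]_3, test_field eta z B ->
     forall (i : 'I_3) (y : 'cV[R]_3), plane eta z y ->
       Inv (fun x xi => v / gammaN *
              matrix_coef (linearized_forward gammaN v eta z B x xi) i (i + 1))
         y
       = component B (i + 2%:R) y).
Proof.
have eta1 : dot eta eta = 1 by rewrite -enorm_sqr heta expr1n.
split; first by move=> K cK; exact: forward_expansion.
split; first by move=> B tB x xi px dxi; exact: forward_linearization.
split; first exact: Radon_inversion_exists.
(* It remains to see that the rescaled linearized data are the line integrals of the component, for
   lines of the plane. *)
move=> Inv hInv B tB i y py; apply: hInv => // x xi px dxi.
have [_ ->] := forward_linearization gammaN v tB px dxi.
by rewrite -invf_div mulKf// mulf_neq0// invr_neq0// gt_eqF.
Qed.
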